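(* There exists a constant $C>0$ such that for every integer $n\ge 5$ there exists an explicit construction of an $(n,5,4)$-system with independence number at most $Cn^{\log_3 2}\le Cn^{0.631}$.
   Context: An $r$-uniform hypergraph ($r$-graph) $\mathcal{H}$ is a family of $r$-subsets of a finite vertex set $V(\mathcal{H})$. A set $I\subset V(\mathcal{H})$ is independent if it contains no edge of $\mathcal{H}$; the independence number $\alpha(\mathcal{H})$ is the maximum size of an independent set. For integers $n\ge r\ge s\ge 1$, an $(n,r,s)$-system is an $r$-graph on $n$ vertices in which every pair of distinct edges has intersection of size less than $s$. For fixed $r\ge s\ge1$, ''there is an explicit construction of an $(n,r,s)$-system with property $\mathcal{P}$'' means there is an algorithm which, on input any integer $n$, runs in time polynomial in $n$ and outputs an $(n,r,s)$-system with property $\mathcal{P}$. *)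

(* Defs.v *)
From mathcomp Require Import all_boot.

Set Implicit Arguments.
Unset Strict Implicit.
Unset Printing Implicit Defensive.

Definition uniform (n r : nat) (H : {set {set 'I_n}}) : Prop :=
  forall E, E \in H -> #|E| = r.

Definition independent (n : nat) (H : {set {set 'I_n}}) (I : {set 'I_n}) :
    bool :=
  [forall E in H, ~~ (E \subset I)].

Definition indep_number (n : nat) (H : {set {set 'I_n}}) : nat :=
  \max_(I : {set 'I_n} | independent H I) #|I|.

Definition is_system (n r s : nat) (H : {set {set 'I_n}}) : Prop :=
  [/\ 1 <= s, s <= r, r <= n, uniform r H &
      forall E F, E \in H -> F \in H -> E != F -> #|E :&: F| < s].

(* Algorithms are programs for a unit-cost random access machine: countably
   many registers holding natural numbers, indirect addressing, and a write-only
   output tape.  Addition and truncated subtraction are the only arithmetic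
   operations (no multiplication), so a register holds O(t + log n) bits after t
   steps and running times agree with Turing-machine times up to a polynomial. *)
Inductive program : Type :=
| Const of nat & nat
| Add of nat & nat & nat
| Sub of nat & nat & nat
| Fetch of nat & nat
| Store of nat & nat
| Output of nat
| Skip
| Seq of program & program
| If of nat & program & program
| While of nat & program.

Definition memory := nat -> nat.

Definition update (m : memory) (x v : nat) : memory :=
  fun y => if y == x then v else m y.

(* [exec p m o m' o' t]: started with registers [m] and output tape [o], the
   program [p] halts after exactly [t] steps with registers [m'] and tape [o'].
   Tests succeed when the tested register is nonzero. *)
Inductive exec : program -> memory -> seq nat ->
                 memory -> seq nat -> nat -> Prop :=
| exec_const x c m o :
    exec (Const x c) m o (update m x c) o 1
| exec_add x y z m o :
    exec (Add x y z) m o (update m x (m y + m z)) o 1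
| exec_sub x y z m o :
    exec (Sub x y z) m o (update m x (m y - m z)) o 1
| exec_fetch x y m o :
    exec (Fetch x y) m o (update m x (m (m y))) o 1
| exec_store x y m o :
    exec (Store x y) m o (update m (m x) (m y)) o 1
| exec_output x m o :
    exec (Output x) m o m (rcons o (m x)) 1
| exec_skip m o :
    exec Skip m o m o 1
| exec_seq p q m o m1 o1 t1 m2 o2 t2 :
    exec p m o m1 o1 t1 -> exec q m1 o1 m2 o2 t2 ->
    exec (Seq p q) m o m2 o2 (t1 + t2)
| exec_if_true x p q m o m1 o1 t :
    m x != 0 -> exec p m o m1 o1 t -> exec (If x p q) m o m1 o1 t.+1
| exec_if_false x p q m o m1 o1 t :
    m x = 0 -> exec q m o m1 o1 t -> exec (If x p q) m o m1 o1 t.+1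
| exec_while_false x p m o :
    m x = 0 -> exec (While x p) m o m o 1
| exec_while_true x p m o m1 o1 t1 m2 o2 t2 :
    m x != 0 -> exec p m o m1 o1 t1 -> exec (While x p) m1 o1 m2 o2 t2 ->
    exec (While x p) m o m2 o2 (t1 + t2).+1.

(* The input is placed in register 0; all other registers start at 0. *)
Definition computes (p : program) (n : nat) (out : seq nat) (t : nat) : Prop :=
  exists m, exec p (update (fun=> 0) 0 n) [::] m out t.

(* [out] is the concatenation of the edges of [H], each edge appearing exactly
   once, as the list of its [r] vertices in some order. *)
Definition lists_edges (n r : nat) (out : seq nat) (H : {set {set 'I_n}}) :
    Prop :=
  exists es : seq (r.-tuple 'I_n),
    out = flatten [seq [seq nat_of_ord v | v <- tval e] | e <- es] /\
    perm_eq [seq [set v in tval e] | e <- es] (enum H).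

(* The program and the polynomial are chosen before the input [n].  For [n < r]
   no (n,r,s)-system exists, and only polynomial running time is required. *)
Definition explicit_construction (r s : nat)
    (P : forall n : nat, {set {set 'I_n}} -> Prop) : Prop :=
  exists (p : program) (a b k : nat), forall n : nat,
    exists (out : seq nat) (t : nat),
      [/\ computes p n out t, t <= a * n ^ k + b &
          r <= n -> exists H : {set {set 'I_n}},
            [/\ lists_edges r out H, is_system r s H & P n H]].

(* Main.v *)
Require Import Defs.
From HB Require Import structures.
From mathcomp Require Import all_boot all_order all_algebra.
From mathcomp Require Import all_fingroup all_solvable all_field.
From mathcomp Require Import all_reals all_analysis.
From mathcomp Require Import boolp zify.

(** Split the 3N vertices of a block, N = 3^l, into three parts of size N. The
    block carries the edges {i, i'} u {j, j'} u {z} with i, i' in part 0, j, j'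
    in part 1, z in part 2 and g^z (g^i + g^i') = g^j + g^j', where g generates
    the multiplicative group of the field with 2^k elements, N < 2^k <= 2N;
    inside the parts the construction is repeated. In characteristic 2 the
    equation is symmetric in i, i' and in j, j', and it determines each of its
    five unknowns from the other four. For fixed z it says that (i, j) and
    (i', j') have the same value of g^(z+i) + g^j, so by pigeonhole an
    independent set meeting part 2 has at most 2^k pairs in part 0 x part 1.
    Hence the independence number at most doubles, up to O(sqrt N), when the
    number of vertices triples.

    A field element x is represented by the bits f(x g^r), r < k, for a linear
    form f. The sequence f(g^j) is produced by a linear feedback shift register,
    whose taps are found by exhaustive search. *)

Set Implicit Arguments.
Unset Strict Implicit.
Unset Printing Implicit Defensive.

Import Order.TTheory GRing.Theory Num.Theory.

(** * Linear feedback shift registers *)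

(** Iteration is encoded as a loop of fixed length [L] with a guard, because the programs built
    later only have loops of exactly [L] rounds. *)
Definition iter_upto (L x : nat) (f : nat -> nat) (y : nat) : nat :=
  iteri L (fun i acc => if i < x then f acc else acc) y.

Lemma iter_uptoE L x f y : x <= L -> iter_upto L x f y = iter x f y.
Proof.
have aux l : iteri l (fun i acc => if i < x then f acc else acc) y
             = iter (minn l x) f y.
  elim: l => [|l IH]; first by rewrite min0n.
  rewrite [LHS]/= IH; have [hl|hl] := boolP (l < x); last rewrite -leqNgt in hl.
    by rewrite (minn_idPl (ltnW hl)) (minn_idPl hl).
  by rewrite (minn_idPr hl) (minn_idPr (leqW hl)).
by move=> xL; rewrite /iter_upto aux (minn_idPr xL).
Qed.

(** For [Q = 2 ^ k] and [u < Q] this is [2u] modulo [Q]: the left shift of a register of [k] bits,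
    dropping the top bit. *)
Definition shift_out (Q u : nat) : nat := u + u - (if Q <= u + u then Q else 0).

Definition msbit (Q u : nat) : bool := Q <= u + u.

Definition bit (L Q u r : nat) : bool :=
  msbit Q (iter_upto L r (shift_out Q) u).

(** The feedback bit: the inner product over the field with two elements of the bit vectors of [c]
    (the taps) and [u] (the state). *)
Definition taps_parity (L Q k c u : nat) : nat :=
  iteri L (fun r acc =>
    if [&& r < k, bit L Q c r & bit L Q u r] then 1 - acc else acc) 0.

Definition lfsr_next (L Q k c u : nat) : nat :=
  shift_out Q u + taps_parity L Q k c u.

Definition lfsr (L Q k c j : nat) : bool :=
  msbit Q (iter_upto L j (lfsr_next L Q k c) 1).

(* Most significant bit first: only doubling, subtraction and comparison are
   then needed to read off the bits. *)
Fixpoint msb_code (f : nat -> bool) (k : nat) : nat :=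
  if k is k'.+1 then f 0 * 2 ^ k' + msb_code (fun i => f i.+1) k' else 0.

Lemma eq_msb_code f g k : (forall i, i < k -> f i = g i) ->
  msb_code f k = msb_code g k.
Proof.
elim: k f g => //= k IH f g fg; rewrite fg //.
by congr (_ + _); apply: IH => i ik; rewrite fg.
Qed.

Lemma msb_code_lt f k : msb_code f k < 2 ^ k.
Proof.
elim: k f => //= k IH f; rewrite expnS.
by have := IH (fun i => f i.+1); case: (f 0) => /=; lia.
Qed.

Lemma msb_codeSr f k : msb_code f k.+1 = (msb_code f k).*2 + f k.
Proof.
elim: k f => [|k IH] f; first by rewrite /= muln1 addn0.
rewrite -[LHS]/(f 0 * 2 ^ k.+1 + msb_code (fun i => f i.+1) k.+1) IH /= expnS.
by lia.
Qed.

Lemma msbit_code f k : 0 < k -> msbit (2 ^ k) (msb_code f k) = f 0.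
Proof.
case: k => // k _; rewrite /msbit /= expnS.
by have := msb_code_lt (fun i => f i.+1) k; case: (f 0) => /=; lia.
Qed.

Lemma shift_out_code f k : shift_out (2 ^ k) (msb_code f k) =
  msb_code (fun i => (i.+1 < k) && f i.+1) k.
Proof.
case: k => [|k]; first by [].
rewrite /shift_out -/(msbit _ _) msbit_code // [RHS]msb_codeSr ltnn addn0.
rewrite [in RHS](@eq_msb_code _ (fun i => f i.+1)) /=; last first.
  by move=> i ik; rewrite ltnS ik.
by rewrite expnS; case: (f 0) => /=; lia.
Qed.

Lemma iter_shift_out_code f k r : iter r (shift_out (2 ^ k)) (msb_code f k) =
  msb_code (fun i => (i + r < k) && f (i + r)) k.
Proof.
elim: r => [|r IH] /=.
  by apply: eq_msb_code => i ik; rewrite addn0 ik.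
rewrite IH shift_out_code; apply: eq_msb_code => i ik.
by rewrite addSnnS; case: ltnP => //= h; apply/esym/negbTE; lia.
Qed.

Lemma bit_code L f k r : r < k -> k <= L ->
  bit L (2 ^ k) (msb_code f k) r = f r.
Proof.
move=> rk kL; rewrite /bit iter_uptoE; last by lia.
by rewrite iter_shift_out_code msbit_code ?add0n ?rk //; lia.
Qed.

Lemma taps_parity_code L k (c f : nat -> bool) : k <= L ->
  taps_parity L (2 ^ k) k (msb_code c k) (msb_code f k) =
  \big[addb/false]_(0 <= r < k) (c r && f r).
Proof.
move=> kL; rewrite /taps_parity.
have aux l : iteri l (fun r acc => if [&& r < k, bit L (2 ^ k) (msb_code c k) r
    & bit L (2 ^ k) (msb_code f k) r] then 1 - acc else acc) 0 =
    \big[addb/false]_(0 <= r < minn l k) (c r && f r).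
  elim: l => [|l IH]; first by rewrite min0n big_nil.
  rewrite [LHS]/= IH; have [lk|lk] := boolP (l < k); last rewrite -leqNgt in lk.
    rewrite (minn_idPl (ltnW lk)) (minn_idPl lk) !bit_code // big_nat_recr //=.
    by case: (c l) (f l) => [] [] /=; case: (\big[_/_]_(_ <= _ < _) _).
  by rewrite (minn_idPr lk) (minn_idPr (leqW lk)).
by rewrite aux (minn_idPr kL).
Qed.

(** Any sequence satisfying a linear recurrence with taps [c] and starting with [0, ..., 0, 1] is
    the output of the register, as long as no loop is cut off at [L]. *)
Lemma lfsr_code L k (c s : nat -> bool) j : 0 < k -> k <= L -> j <= L ->
  (forall i, s (i + k) = \big[addb/false]_(0 <= r < k) (c r && s (i + r))) ->
  (forall r, r < k -> s r = (r == k.-1)) ->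
  lfsr L (2 ^ k) k (msb_code c k) j = s j.
Proof.
move=> k0 kL jL srec s0.
(* Invariant: after [i] steps the state holds the window [s i, ..., s (i + k - 1)]. The initial
   state [1] is the window [0, ..., 0, 1]. *)
have st i : iter i (lfsr_next L (2 ^ k) k (msb_code c k)) 1 =
            msb_code (fun r => s (i + r)) k.
  elim: i => [|i IH].
    case: k k0 s0 {srec kL} => // k _ s0.
    rewrite [RHS]msb_codeSr [in RHS](@eq_msb_code _ (fun=> false)); last first.
      by move=> r rk; rewrite add0n s0; [apply/negbTE; lia | lia].
    rewrite add0n s0 // eqxx /=.
    suff -> : msb_code (fun=> false) k = 0 by [].
    by elim: k {s0} => //= k ->.
  rewrite iterS IH /lfsr_next taps_parity_code // -srec shift_out_code.
  case: k k0 {srec s0 kL IH} => // k _.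
  rewrite !msb_codeSr ltnn addn0; congr (_.*2 + _); last first.
    by rewrite addSnnS.
  by apply: eq_msb_code => r rk /=; rewrite ltnS rk addSnnS.
by rewrite /lfsr iter_uptoE // st msbit_code // addn0.
Qed.

(** * Maximal sequences from finite fields of characteristic 2 *)

Section BinaryField.
Local Open Scope ring_scope.

Lemma F2_addb (x y : 'F_2) : (x + y != 0) = (x != 0) (+) (y != 0).
Proof. by case: x y => [[|[|]] //= ?] [[|[|]] //= ?]. Qed.

Lemma F2_andb (x y : 'F_2) : (x * y != 0) = (x != 0) && (y != 0).
Proof. by rewrite mulf_eq0 negb_or. Qed.

Lemma F2_big_addb (k : nat) (f : nat -> 'F_2) :
  (\sum_(0 <= r < k) f r != 0) = \big[addb/false]_(0 <= r < k) (f r != 0).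
Proof. by elim/big_rec2: _ => [|i y1 y2 _ <-]; rewrite ?eqxx // F2_addb. Qed.

Lemma exists_power_generator (F : finFieldType) :
  exists g : F, [/\ g != 0, forall x, x != 0 -> exists i, x = g ^+ i &
    forall i j, (i < j < #|F|.-1)%N -> g ^+ i != g ^+ j].
Proof.
have /cyclicP[u Du] : cyclic [set: {unit F}] by apply: field_unit_group_cyclic.
exists (FinRing.uval u).
split=> [|x x0|i j /andP[ij jF]]; first by rewrite -unitfE; case: u {Du}.
  have /cycleP[i ui] : finField_unit x0 \in <[u]>%g by rewrite -Du inE.
  by exists i; rewrite -FinRing.val_unitX -ui.
rewrite -!FinRing.val_unitX (inj_eq val_inj) eq_expg_mod_order.
have -> : #[u]%g = #|F|.-1 by rewrite orderE -Du card_finField_unit.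
by rewrite !modn_small ?(ltn_trans ij) // neq_ltn ij.
Qed.

(** Every element is zero or a power of [g], so adjoining [g] to the ground field gives all of [L].
    Hence [g] has degree [\dim L], and polynomials in [g] of smaller degree reach every element. *)
Lemma powers_basis (F0 : finFieldType) (L : fieldExtType F0) (g : L) :
  (forall x, x != 0 -> exists i, x = g ^+ i) ->
  basis_of {:L} [tuple g ^+ i | i < \dim {:L}].
Proof.
move=> gen; set k := \dim {:L}.
have full : <<1; g>>%VS = {:L}%VS.
  apply/eqP; rewrite eqEsubv subvf; apply/subvP => x _.
  have [->|/gen[i ->]] := eqVneq x 0; first exact: mem0v.
  by apply: rpredX; apply: memv_adjoin.
have dk : adjoin_degree 1 g = k.
  by have := dim_Fadjoin 1 g; rewrite full dimv1 muln1.
rewrite basisEdim size_tuple leqnn andbT; apply/subvP => x _.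
have := Fadjoin_poly_eq (_ : x \in <<1; g>>%VS); rewrite full memvf.
move=> /(_ isT) <-.
have sz := size_Fadjoin_poly 1 g x; rewrite dk in sz.
rewrite (horner_coef_wide _ sz); apply: rpred_sum => i _.
have /polyOverP/(_ i)/vlineP[a ->] := Fadjoin_polyOver 1 g x.
rewrite -scalerAl mul1r; apply: rpredZ; apply: memv_span.
by apply/mapP; exists i; rewrite ?mem_ord_enum ?mem_enum.
Qed.

(** The sequence is [s j = l (g ^ j)] for a nonzero linear form [l]. The taps are the coordinates of
    [g ^ k] in the basis of powers, and the last clause holds because the bilinear form [l (x * y)]
    is nondegenerate. *)
Lemma mseq_of_generator (L : fieldExtType 'F_2) (g : L) (k := \dim {:L}) :
  (forall x, x != 0 -> exists i, x = g ^+ i) ->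
  exists c s : nat -> bool,
  [/\ forall i, s (i + k)%N = \big[addb/false]_(0 <= r < k)
        (c r && s (i + r)%N),
      forall r, (r < k)%N -> s r = (r == k.-1) &
      forall x1 x2 x3 x4,
        (forall r, (r < k)%N ->
           s (x1 + r)%N (+) s (x2 + r)%N (+) s (x3 + r)%N (+) s (x4 + r)%N
             = false) ->
        g ^+ x1 + g ^+ x2 + g ^+ x3 + g ^+ x4 = 0].
Proof.
move=> gen; have k0 : (0 < k)%N by rewrite /k adim_gt0.
have bX := powers_basis gen; rewrite -/k in bX; set X := mktuple _ in bX.
have [_ fX] := andP bX.
have Xk (i : 'I_k) : X`_i = g ^+ i by rewrite -tnth_nth tnth_mktuple.
have expand (x : L) : x = \sum_(r < k) coord X r x *: g ^+ r.
  rewrite {1}(coord_basis bX (memvf x)).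
  by apply: eq_bigr => i _; rewrite Xk.
have km : (k.-1 < k)%N by rewrite prednK.
pose top := Ordinal km.
(* Taking the coordinate along [g ^ (k - 1)] as linear form makes the first [k] values
   [0, ..., 0, 1]. *)
pose l (x : L) : 'F_2 := coord X top x.
pose cc r : 'F_2 := if insub r is Some i then coord X i (g ^+ k) else 0.
have lD x y : l (x + y) = l x + l y by rewrite /l raddfD.
exists (fun r => cc r != 0), (fun j => l (g ^+ j) != 0); split=> //.
- move=> i; under eq_bigr do rewrite -F2_andb.
  rewrite -F2_big_addb; congr (_ != 0); rewrite exprD.
  have -> : g ^+ i * g ^+ k = \sum_(r < k) cc r *: g ^+ (i + r).
    rewrite {1}(expand (g ^+ k)) mulr_sumr; apply: eq_bigr => r _.
    by rewrite -scalerAr -exprD /cc valK.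
  rewrite /l linear_sum big_mkord; apply: eq_bigr => r _.
  by rewrite linearZ.
- move=> r rk; rewrite /l -(Xk (Ordinal rk)) coord_free //.
  rewrite -[r == _]/(val (Ordinal rk) == val top) val_eqE.
  by case: (Ordinal rk == top); rewrite ?eqxx ?oner_eq0.
move=> x1 x2 x3 x4 H; set w := _ + _ + _ + _.
have lw (r : nat) : (r < k)%N -> l (w * g ^+ r) = 0.
  move=> rk; apply/eqP; move: (H r rk); rewrite -!F2_addb -!lD => /negbFE.
  by rewrite !mulrDl -!exprD.
have lwx (x : L) : l (w * x) = 0.
  rewrite (expand x) mulr_sumr /l linear_sum big1 // => r _.
  by rewrite -scalerAr linearZ /= -/(l _) lw ?mulr0.
apply/eqP; apply/negPn/negP => w0.
(* The form vanishes on all multiples of [w]. If [w] were invertible, [g ^ (k - 1)] would be such a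
   multiple, but its image is 1. *)
have := lwx (w^-1 * g ^+ k.-1); rewrite mulrA divff // mul1r /l.
by rewrite -(Xk top) coord_free // eqxx => /eqP; rewrite oner_eq0.
Qed.

Lemma exists_mseq k : (0 < k)%N ->
  exists (F : fieldType) (g : F) (c s : nat -> bool),
  [/\ g != 0 /\ 2%N \in [pchar F],
      forall i j, (i < j < (2 ^ k).-1)%N -> g ^+ i != g ^+ j,
      forall i, s (i + k)%N = \big[addb/false]_(0 <= r < k)
        (c r && s (i + r)%N),
      forall r, (r < k)%N -> s r = (r == k.-1) &
      forall x1 x2 x3 x4,
        (forall r, (r < k)%N ->
           s (x1 + r)%N (+) s (x2 + r)%N (+) s (x3 + r)%N (+) s (x4 + r)%N
             = false) ->
        g ^+ x1 + g ^+ x2 + g ^+ x3 + g ^+ x4 = 0].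
Proof.
move=> k0; have [F0 ch2 cF0] := pPrimePowerField (isT : prime 2) k0.
pose F := pPrimeCharType ch2.
have [g [g0 gen ginj]] := exists_power_generator F0.
have dimF : \dim {: F : vectType _} = k.
  by rewrite pprimeChar_dimf cF0 pfactorK.
have [c [s]] := @mseq_of_generator F g gen; rewrite dimF => -[h1 h2 h3].
by exists F, g, c, s; split=> // i j; rewrite -cF0; apply: ginj.
Qed.

End BinaryField.

(** * Sums of four powers and separating sequences *)

Definition vanish (L k : nat) (s : nat -> bool) (a b c d : nat) : bool :=
  all (fun r => (r < k) ==>
         ~~ (s (a + r) (+) s (b + r) (+) s (c + r) (+) s (d + r))) (iota 0 L).

(* Both conditions can be tested in polynomial time, and they are all that is
   needed of [s]; finite fields only serve to show that suitable taps exist. *)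
Definition separating (L N k : nat) (s : nat -> bool) : bool :=
  all (fun z => all (fun z' => all (fun i => all (fun i' =>
    [&& z < N, z' < N, i < N, i' < N & i != i'] ==>
    ~~ vanish L k s (z + i) (z + i') 0 0 &&
    ((z != z') ==> ~~ vanish L k s (z + i) (z + i') (z' + i) (z' + i')))
    (iota 0 L)) (iota 0 L)) (iota 0 L)) (iota 0 L).

Lemma all_iotaP L (P : pred nat) :
  reflect (forall i, i < L -> P i) (all P (iota 0 L)).
Proof.
apply: (iffP allP) => H i; first by move=> iL; apply: H; rewrite mem_iota.
by rewrite mem_iota => /andP[_ /H].
Qed.

Section Vanish.
Variables (L k : nat) (s : nat -> bool).
Hypothesis kL : k <= L.
Local Notation van := (vanish L k s).

(** For the sequences obtained from a generator [g], these [k] bit equations express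
    [g^a + g^b + g^c + g^d = 0]. *)
Lemma vanishP a b c d :
  reflect (forall r, r < k ->
             s (a + r) (+) s (b + r) (+) s (c + r) (+) s (d + r) = false)
          (van a b c d).
Proof.
apply: (iffP (all_iotaP _ _)) => H r.
  by move=> rk; have /implyP/(_ rk)/negbTE := H r (leq_trans rk kL).
by move=> _; apply/implyP => /H ->.
Qed.

Lemma vanishCl a b c d : van a b c d = van b a c d.
Proof.
by apply: eq_all => r; rewrite [X in X (+) _ (+) _]addbC.
Qed.

Lemma vanishCr a b c d : van a b c d = van a b d c.
Proof.
by apply: eq_all => r; rewrite -addbA [X in _ (+) X]addbC addbA.
Qed.

(** The two equations are added; terms occurring twice cancel in characteristic 2. *)
Lemma vanish_trans a b c d x y : van a b x y -> van c d x y -> van a b c d.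
Proof.
move=> /vanishP h1 /vanishP h2; apply/vanishP => r rk.
move: (h1 r rk) (h2 r rk).
by case: (s _) (s _) (s _) (s _) (s _) (s _) => [] [] [] [] [] [].
Qed.

(** The entries [0 0] are padding: two equal terms cancel, which leaves an equation between two
    powers. *)
Lemma vanish_cancell a b b' c d : van a b c d -> van a b' c d -> van b b' 0 0.
Proof.
move=> /vanishP h1 /vanishP h2; apply/vanishP => r rk.
move: (h1 r rk) (h2 r rk).
by case: (s _) (s _) (s _) (s _) (s _) (s _) => [] [] [] [] [] [].
Qed.

Lemma vanish_cancelr a b c d d' : van a b c d -> van a b c d' -> van d d' 0 0.
Proof.
move=> /vanishP h1 /vanishP h2; apply/vanishP => r rk.
move: (h1 r rk) (h2 r rk).
by case: (s _) (s _) (s _) (s _) (s _) (s _) => [] [] [] [] [] [].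
Qed.

Variable N : nat.
Hypothesis NL : N <= L.

(** In terms of a generator [g], the first condition says that [g^(z+i)] and [g^(z+i')] differ, the
    second that [(g^z + g^z') (g^i + g^i')] is nonzero. *)
Lemma separatingP : reflect
  (forall z z' i i', z < N -> z' < N -> i < N -> i' < N -> i != i' ->
     ~~ van (z + i) (z + i') 0 0 /\
     (z != z' -> ~~ van (z + i) (z + i') (z' + i) (z' + i')))
  (separating L N k s).
Proof.
apply: (iffP idP) => [H z z' i i' hz hz' hi hi' ii'|H].
  move/all_iotaP/(_ z (leq_trans hz NL))/all_iotaP: H.
  move/(_ z' (leq_trans hz' NL))/all_iotaP/(_ i (leq_trans hi NL)).
  move/all_iotaP/(_ i' (leq_trans hi' NL)).
  by rewrite hz hz' hi hi' ii' /= => /andP[-> /implyP].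
do 4!(apply/all_iotaP => ? _); apply/implyP => /and5P[h1 h2 h3 h4 h5].
have [-> h] := H _ _ _ _ h1 h2 h3 h4 h5.
exact/implyP.
Qed.

(** The pair [(i, j)] is sent to the [k] bits representing [g^(z+i) + g^j]. A collision of two pairs
    is an instance of the edge equation, so it suffices that this map is injective. *)
Lemma pigeonhole z (A B : seq nat) : separating L N k s -> z < N ->
  uniq A -> uniq B -> all (gtn N) A -> all (gtn N) B ->
  (forall i i' j j', i \in A -> i' \in A -> j \in B -> j' \in B ->
     i < i' -> j < j' -> ~~ van (z + i) (z + i') j j') ->
  size A * size B <= 2 ^ k.
Proof.
move=> /separatingP sep zN uA uB /allP AN /allP BN noR.
pose f (p : nat * nat) : {ffun 'I_k -> bool} :=
  [ffun r : 'I_k => s (z + p.1 + r) (+) s (p.2 + r)].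
pose l := [seq (i, j) | i <- A, j <- B].
have fE p q : f p = f q -> van (z + p.1) (z + q.1) p.2 q.2.
  move=> /ffunP fpq; apply/vanishP => r rk.
  have := fpq (Ordinal rk); rewrite !ffunE /=.
  by do 4!case: (s _).
have noR' i i' j j' : i \in A -> i' \in A -> j \in B -> j' \in B ->
    i != i' -> j != j' -> ~~ van (z + i) (z + i') j j'.
  move=> iA i'A jB j'B; rewrite !neq_ltn => /orP[ii|ii] /orP[jj|jj].
  - exact: noR.
  - by rewrite vanishCr; apply: noR.
  - by rewrite vanishCl; apply: noR.
  - by rewrite vanishCl vanishCr; apply: noR.
have injf : {in l &, injective f}.
  move=> p q /allpairsP[[i j] /= [iA jB ->]].
  move=> /allpairsP[[i' j'] /= [i'A j'B ->]] /fE /= h.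
  have z0 : 0 < N by lia.
  have [ii|ii] := eqVneq i i'; have [jj|jj] := eqVneq j j'.
  - by rewrite ii jj.
  (* When [i = i'] the collision reduces to [g^j = g^j'], which the first separating condition
     excludes at [z = 0]. *)
  - have [+ _] := sep 0 0 _ _ z0 z0 (BN _ jB) (BN _ j'B) jj.
    rewrite !add0n => /negP[]; apply/vanishP => r rk.
    move/vanishP/(_ r rk): h; rewrite ii addbb /= => ->.
    by rewrite addFb addbb.
  - have [+ _] := sep z z _ _ zN zN (AN _ iA) (AN _ i'A) ii.
    move=> /negP[]; apply/vanishP => r rk.
    by move/vanishP/(_ r rk): h; rewrite jj -!addbA !addbb.
  - by have /negP[] := noR' _ _ _ _ iA i'A jB j'B ii jj.
rewrite -(size_allpairs pair) -/l -(size_map f).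
have u : uniq (map f l).
  rewrite map_inj_in_uniq //; apply: allpairs_uniq => //.
  by move=> [? ?] [? ?] _ _ [-> ->].
rewrite -(card_uniqP u); apply: leq_trans (max_card _) _.
by rewrite card_ffun card_bool card_ord.
Qed.

End Vanish.

Lemma eq_in_vanish L k s s' a b c d : k <= L ->
  (forall r, r < k -> [/\ s (a + r) = s' (a + r), s (b + r) = s' (b + r),
     s (c + r) = s' (c + r) & s (d + r) = s' (d + r)]) ->
  vanish L k s a b c d = vanish L k s' a b c d.
Proof.
move=> kL e; apply: eq_in_all => r _.
by case: ltnP => //= rk; have [-> -> -> ->] := e r rk.
Qed.

(** [N < 2 ^ k] makes the powers [g ^ i] with [i < N] distinct, [2 ^ k <= L] puts the code of the
    taps in the range of the search, and [N + N + k <= L] keeps all indices [z + i + r] where [lfsr]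
    agrees with the ideal sequence. *)
Lemma exists_taps L N k : N < 2 ^ k -> 0 < N -> k <= L -> 2 ^ k <= L ->
  N + N + k <= L -> exists2 c, c < L & separating L N k (lfsr L (2 ^ k) k c).
Proof.
move=> N2 N0 kL QL NkL.
have k0 : 0 < k by case: k N2 {kL QL NkL}; lia.
have [F [g [c [s [[g0 ch2] ginj srec sinit svan]]]]] := exists_mseq k0.
exists (msb_code c k); first by apply: leq_trans QL; apply: msb_code_lt.
have lE j : j <= L -> lfsr L (2 ^ k) k (msb_code c k) j = s j.
  by move=> jL; apply: lfsr_code.
have gneq i j : i < N -> j < N -> i != j -> (g ^+ i + g ^+ j != 0)%R.
  move=> iN jN; rewrite GRing.addr_eq0 (GRing.oppr_pchar2 ch2) neq_ltn.
  by case/orP => h; [|rewrite eq_sym]; apply: ginj; lia.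
apply/separatingP; first by lia.
move=> z z' i i' hz hz' hi hi' ii'; split=> [|zz'].
  apply/negP; rewrite (@eq_in_vanish _ _ _ s) //; last first.
    by move=> r rk; rewrite !lE //; lia.
  move/(vanishP _ kL)/svan; rewrite GRing.expr0 -GRing.addrA.
  rewrite (GRing.addrr_pchar2 ch2) GRing.addr0 !GRing.exprD -GRing.mulrDr.
  apply/eqP; rewrite GRing.mulf_eq0 negb_or GRing.expf_neq0 //.
  exact: gneq.
apply/negP; rewrite (@eq_in_vanish _ _ _ s) //; last first.
  by move=> r rk; rewrite !lE //; lia.
move/(vanishP _ kL)/svan; rewrite !GRing.exprD -GRing.mulrDr -GRing.addrA.
rewrite -GRing.mulrDr -GRing.mulrDl; apply/eqP.
by rewrite GRing.mulf_eq0 negb_or !gneq.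
Qed.

(** * Polynomial-time programs *)

(* Register 0 holds the loop bound [L]; [rho] assigns to the variables of the
   environment registers below [d]. The program leaves the registers below [d]
   unchanged, puts the value of [f] in register [d] and outputs [G]. Since every
   loop has exactly [L] iterations, running times are polynomial in [L] whatever
   values are computed. *)
Definition proc (f : nat -> (nat -> nat) -> nat)
    (G : nat -> (nat -> nat) -> seq nat) : Prop :=
  forall (d : nat) (rho : nat -> nat), 0 < d -> (forall j, rho j < d) ->
  exists (p : program) (c k : nat), forall m o, exists m' t,
    [/\ exec p m o m' (o ++ G (m 0) (m \o rho)) t,
        forall i, i < d -> m' i = m i,
        m' d = f (m 0) (m \o rho) & t <= c * (m 0).+1 ^ k].

Definition computable (f : nat -> (nat -> nat) -> nat) : Prop :=
  proc f (fun _ _ => [::]).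

Lemma agree_comp (m m' rho : nat -> nat) d : (forall j, rho j < d) ->
  (forall i, i < d -> m' i = m i) -> m' \o rho = m \o rho.
Proof. by move=> rd e; apply/funext => j /=; rewrite e. Qed.

Lemma poly_leq L c k c' k' : c <= c' -> k <= k' ->
  c * L.+1 ^ k <= c' * L.+1 ^ k'.
Proof. by move=> cc kk; rewrite leq_mul // leq_pexp2l. Qed.

Lemma poly_add L t1 t2 c1 k1 c2 k2 : t1 <= c1 * L.+1 ^ k1 ->
  t2 <= c2 * L.+1 ^ k2 -> t1 + t2 <= (c1 + c2) * L.+1 ^ (k1 + k2).
Proof.
move=> h1 h2; rewrite mulnDl; apply: leq_add.
  by apply: leq_trans h1 _; apply: poly_leq; rewrite ?leq_addr.
by apply: leq_trans h2 _; apply: poly_leq; rewrite ?leq_addl.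
Qed.

Lemma poly_addn L t c k b : t <= c * L.+1 ^ k -> t + b <= (c + b) * L.+1 ^ k.
Proof.
by move=> h; rewrite -[k]addn0; apply: poly_add => //; rewrite expn0 muln1.
Qed.

Ltac upd := rewrite /update; repeat (case: eqP => ? //); try lia.

Lemma eq_proc f G f' G' : proc f G -> (forall L e, f L e = f' L e) ->
  (forall L e, G L e = G' L e) -> proc f' G'.
Proof.
move=> h ff' GG'; have -> : f' = f by apply/funext => L; apply/funext => e.
by have -> : G' = G by apply/funext => L; apply/funext => e.
Qed.

Lemma computable_var i : computable (fun _ e => e i).
Proof.
(* Without a copy instruction, a register is copied by adding it to a zero. *)
move=> d rho d0 rd; exists (Seq (Const d 0) (Add d (rho i) d)), 2, 0.
move=> m o; rewrite cats0; do 2 eexists; split.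
- by eapply exec_seq; [exact: exec_const | exact: exec_add].
- by move=> j jd; upd.
- by have := rd i; upd; rewrite /= addn0.
- by [].
Qed.

Lemma computable_const c : computable (fun _ _ => c).
Proof.
move=> d rho d0 rd; exists (Const d c), 1, 0.
move=> m o; rewrite cats0; do 2 eexists; split; first exact: exec_const.
- by move=> j jd; upd.
- by upd.
- by [].
Qed.

Lemma proc_seq f1 G1 f2 G2 : proc f1 G1 -> proc f2 G2 ->
  proc f2 (fun L e => G1 L e ++ G2 L e).
Proof.
move=> h1 h2 d rho d0 rd.
have [p1 [c1 [k1 e1]]] := h1 d rho d0 rd.
have [p2 [c2 [k2 e2]]] := h2 d rho d0 rd.
exists (Seq p1 p2), (c1 + c2), (k1 + k2) => m o.
have [m1 [t1 [x1 a1 _ b1]]] := e1 m o.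
have [m2 [t2 [x2 a2 v2 b2]]] := e2 m1 (o ++ G1 (m 0) (m \o rho)).
rewrite (agree_comp rd a1) (a1 0 d0) in x2 v2 b2.
exists m2, (t1 + t2); split.
- by rewrite catA; apply: exec_seq x1 x2.
- by move=> i id; rewrite a2 // a1.
- exact: v2.
- exact: poly_add.
Qed.

(** The second summand is evaluated with [d.+1] as its first free register, so the value of the
    first survives in register [d]. *)
Lemma computable_add x y : computable x -> computable y ->
  computable (fun L e => x L e + y L e).
Proof.
move=> h1 h2 d rho d0 rd.
have [p1 [c1 [k1 e1]]] := h1 d rho d0 rd.
have [p2 [c2 [k2 e2]]] := h2 d.+1 rho isT (fun j => leqW (rd j)).
exists (Seq p1 (Seq p2 (Add d d d.+1))), (c1 + c2 + 1), (k1 + k2) => m o.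
have [m1 [t1 [x1 a1 v1 b1]]] := e1 m o.
have [m2 [t2 [x2 a2 v2 b2]]] := e2 m1 o.
rewrite cats0 in x1; rewrite !cats0 in x2 *.
rewrite (agree_comp rd a1) (a1 0 d0) in v2 b2.
do 2 eexists; split.
- eapply exec_seq; first exact: x1.
  by eapply exec_seq; [exact: x2 | exact: exec_add].
- by move=> i id; upd; rewrite a2 ?a1 //; lia.
- by upd; rewrite v2 a2 // v1.
- by rewrite addnA; apply: poly_addn; apply: poly_add.
Qed.

Lemma computable_sub x y : computable x -> computable y ->
  computable (fun L e => x L e - y L e).
Proof.
move=> h1 h2 d rho d0 rd.
have [p1 [c1 [k1 e1]]] := h1 d rho d0 rd.
have [p2 [c2 [k2 e2]]] := h2 d.+1 rho isT (fun j => leqW (rd j)).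
exists (Seq p1 (Seq p2 (Defs.Sub d d d.+1))), (c1 + c2 + 1), (k1 + k2) => m o.
have [m1 [t1 [x1 a1 v1 b1]]] := e1 m o.
have [m2 [t2 [x2 a2 v2 b2]]] := e2 m1 o.
rewrite cats0 in x1; rewrite !cats0 in x2 *.
rewrite (agree_comp rd a1) (a1 0 d0) in v2 b2.
do 2 eexists; split.
- eapply exec_seq; first exact: x1.
  by eapply exec_seq; [exact: x2 | exact: exec_sub].
- by move=> i id; upd; rewrite a2 ?a1 //; lia.
- by upd; rewrite v2 a2 // v1.
- by rewrite addnA; apply: poly_addn; apply: poly_add.
Qed.

Lemma proc_if x f1 G1 f2 G2 : computable (fun L e => nat_of_bool (x L e)) ->
  proc f1 G1 -> proc f2 G2 ->
  proc (fun L e => if x L e then f1 L e else f2 L e)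
       (fun L e => if x L e then G1 L e else G2 L e).
Proof.
move=> hx h1 h2 d rho d0 rd.
have [p0 [c0 [k0 e0]]] := hx d rho d0 rd.
have [p1 [c1 [k1 e1]]] := h1 d rho d0 rd.
have [p2 [c2 [k2 e2]]] := h2 d rho d0 rd.
exists (Seq p0 (If d p1 p2)), (c0 + (c1 + c2) + 1), (k0 + (k1 + k2)) => m o.
have [m0 [t0 [x0 a0 v0 b0]]] := e0 m o; rewrite cats0 in x0.
case xE: (x (m 0) (m \o rho)); rewrite xE /= in v0.
  have [m1 [t1 [x1 a1 v1 b1]]] := e1 m0 o.
  rewrite (agree_comp rd a0) (a0 0 d0) in x1 v1 b1.
  exists m1, (t0 + t1.+1); split=> //.
  - by apply: exec_seq x0 _; apply: exec_if_true => //; rewrite v0.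
  - by move=> i id; rewrite a1 ?a0.
  - rewrite -[t1.+1]addn1 addnA; apply: poly_addn; apply: poly_add => //.
    by apply: leq_trans b1 _; apply: poly_leq; rewrite leq_addr.
have [m1 [t1 [x1 a1 v1 b1]]] := e2 m0 o.
rewrite (agree_comp rd a0) (a0 0 d0) in x1 v1 b1.
exists m1, (t0 + t1.+1); split=> //.
- by apply: exec_seq x0 _; apply: exec_if_false.
- by move=> i id; rewrite a1 ?a0.
- rewrite -[t1.+1]addn1 addnA; apply: poly_addn; apply: poly_add => //.
  by apply: leq_trans b1 _; apply: poly_leq; rewrite leq_addl.
Qed.

Lemma proc_emit x : computable x -> proc x (fun L e => [:: x L e]).
Proof.
move=> hx d rho d0 rd.
have [p1 [c1 [k1 e1]]] := hx d rho d0 rd.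
exists (Seq p1 (Output d)), (c1 + 1), k1 => m o.
have [m1 [t1 [x1 a1 v1 b1]]] := e1 m o; rewrite cats0 in x1.
exists m1, (t1 + 1); split=> //; last exact: poly_addn.
by apply: exec_seq x1 _; rewrite cats1 -v1; apply: exec_output.
Qed.

(** Variables are de Bruijn indices: inside the body, variable 0 is the loop index, variable 1 the
    accumulator, and the outer variables are shifted by two. *)
Lemma proc_loop f0 f G : computable f0 ->
  proc (fun L e => f L (e 0) (e 1) (fun j => e j.+2))
       (fun L e => G L (e 0) (fun j => e j.+2)) ->
  proc (fun L e => iteri L (fun i acc => f L i acc e) (f0 L e))
       (fun L e => flatten [seq G L i e | i <- iota 0 L]).
Proof.
move=> h0 hf d rho d0 rd.
have [p0 [c0 [k0 e0]]] := h0 d rho d0 rd.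
pose rho' j := match j with 0 => d.+1 | 1 => d | j'.+2 => rho j' end.
have rd' j : rho' j < d.+1.+4.
  by case: j => [|[|j]] /=; [lia | lia | have := rd j; lia].
have [p1 [c1 [k1 e1]]] := hf d.+1.+4 rho' isT rd'.
(* Register [d] holds the accumulator, [d.+1] the index, [d.+2] the number of rounds left, [d.+3]
   the constant 1 and [d.+4] the constant 0. The body leaves its result in [d.+1.+4], from where it
   is copied to [d]. *)
pose body := Seq p1 (Seq (Add d d.+1.+4 d.+4)
  (Seq (Add d.+1 d.+1 d.+3) (Defs.Sub d.+2 d.+2 d.+3))).
exists (Seq p0 (Seq (Const d.+1 0) (Seq (Const d.+3 1) (Seq (Const d.+4 0)
  (Seq (Add d.+2 0 d.+4) (While d.+2 body)))))).
exists (c0 + (c1 + 5) + 4), (k0 + k1.+1) => m o.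
set L := m 0; set e := m \o rho; set f' := fun i acc => f L i acc e.
have loop r : forall i mm oo, i + r = L -> (forall j, j < d -> mm j = m j) ->
    mm d = iteri i f' (f0 L e) -> mm d.+1 = i -> mm d.+2 = r ->
    mm d.+3 = 1 -> mm d.+4 = 0 ->
    exists m' t, [/\ exec (While d.+2 body) mm oo m'
        (oo ++ flatten [seq G L i e | i <- iota i r]) t,
      forall j, j < d -> m' j = m j, m' d = iteri (i + r) f' (f0 L e) &
      t <= r * (c1 * L.+1 ^ k1 + 4) + 1].
  elim: r => [|r IH] i mm oo ir am v0 v1 v2 v3 v4.
    exists mm, 1; rewrite /= cats0 addn0; split=> //.
    exact: exec_while_false.
  have [m1 [t1 [x1 a1 w1 b1]]] := e1 mm oo.
  have mm0 : mm 0 = L by rewrite am.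
  rewrite /= mm0 v0 v1 -/(mm \o rho) (agree_comp rd am) -/e in x1 w1 b1.
  pose m2 := update m1 d (m1 d.+1.+4 + m1 d.+4).
  pose m3 := update m2 d.+1 (m2 d.+1 + m2 d.+3).
  pose m4 := update m3 d.+2 (m3 d.+2 - m3 d.+3).
  have u1 : m1 d.+1 = i by rewrite a1 ?v1 //; lia.
  have u2 : m1 d.+2 = r.+1 by rewrite a1 ?v2 //; lia.
  have u3 : m1 d.+3 = 1 by rewrite a1 ?v3 //; lia.
  have u4 : m1 d.+4 = 0 by rewrite a1 ?v4 //; lia.
  have [|||||||m' [t [x a w b]]] := IH i.+1 m4 (oo ++ G L i e).
  - by lia.
  - by move=> j jd; rewrite /m4 /m3 /m2; upd; rewrite a1 ?am //; lia.
  - by rewrite /m4 /m3 /m2; upd; rewrite w1 u4 addn0.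
  - by rewrite /m4 /m3 /m2; upd; rewrite u1 u3 addn1.
  - by rewrite /m4 /m3 /m2; upd; rewrite u2 u3 subn1.
  - by rewrite /m4 /m3 /m2; upd.
  - by rewrite /m4 /m3 /m2; upd.
  exists m', (t1 + (1 + (1 + 1)) + t).+1; split=> //.
  - apply: exec_while_true; first by rewrite v2.
      apply: exec_seq x1 _; apply: exec_seq; first exact: exec_add.
      by apply: exec_seq; [exact: exec_add | exact: exec_sub].
    by move: x; rewrite /= catA.
  - by rewrite w addSnnS.
  - by rewrite mulSn; lia.
have [m0 [t0 [x0 a0 v0 b0]]] := e0 m o; rewrite cats0 in x0.
pose m1 := update m0 d.+1 0.
pose m2 := update m1 d.+3 1.
pose m3 := update m2 d.+4 0.
pose m4 := update m3 d.+2 (m3 0 + m3 d.+4).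
have m00 : m0 0 = L by rewrite a0.
have [|||||||m' [t [x a w b]]] := loop L 0 m4 o.
- by [].
- by move=> j jd; rewrite /m4 /m3 /m2 /m1; upd; rewrite a0 //; lia.
- by rewrite /m4 /m3 /m2 /m1; upd.
- by rewrite /m4 /m3 /m2 /m1; upd.
- by rewrite /m4 /m3 /m2 /m1; upd; rewrite addn0.
- by rewrite /m4 /m3 /m2 /m1; upd.
- by rewrite /m4 /m3 /m2 /m1; upd.
exists m', (t0 + (1 + (1 + (1 + (1 + t))))); split=> //.
  apply: exec_seq x0 _; apply: exec_seq; first exact: exec_const.
  apply: exec_seq; first exact: exec_const.
  apply: exec_seq; first exact: exec_const.
  by apply: exec_seq; first exact: exec_add.
have -> : t0 + (1 + (1 + (1 + (1 + t)))) = t0 + t + 4 by lia.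
apply: poly_addn; apply: poly_add => //; apply: leq_trans b _.
have p1_gt0 : 0 < L.+1 ^ k1 by rewrite expn_gt0.
by rewrite expnS; nia.
Qed.

(** * Combinators for computable functions, decidable predicates and output *)

Definition decides (P : nat -> (nat -> nat) -> bool) : Prop :=
  computable (fun L e => nat_of_bool (P L e)).

Definition emits (G : nat -> (nat -> nat) -> seq nat) : Prop :=
  proc (fun _ _ => 0) G.

Lemma eq_computable f g : computable f -> (forall L e, f L e = g L e) ->
  computable g.
Proof. by move=> h fg; apply: eq_proc h fg _. Qed.

(** Renaming needs no instruction: [proc] holds for every assignment of registers to variables, in
    particular for [rho \o s]. *)
Lemma computable_rename (s : nat -> nat) f : computable f ->
  computable (fun L e => f L (fun j => e (s j))).
Proof. by move=> h d rho d0 rd; apply: (h d (rho \o s)) => // j; apply: rd. Qed.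

Lemma computable_shift f : computable f ->
  computable (fun L e => f L (fun j => e j.+1)).
Proof. exact: computable_rename. Qed.

Lemma decides_shift P : decides P -> decides (fun L e => P L (fun j => e j.+1)).
Proof. exact: computable_rename. Qed.

Lemma computable_if P f g : decides P -> computable f -> computable g ->
  computable (fun L e => if P L e then f L e else g L e).
Proof.
move=> hP hf hg; apply: (eq_proc (proc_if hP hf hg)) => // L e.
by case: (P L e).
Qed.

Lemma computable_loop f0 f : computable f0 ->
  computable (fun L e => f L (e 0) (e 1) (fun j => e j.+2)) ->
  computable (fun L e => iteri L (fun i acc => f L i acc e) (f0 L e)).
Proof.
move=> h0 hf; apply: (eq_proc (@proc_loop f0 f (fun _ _ _ => [::]) h0 hf)) => //.
by move=> L e; elim: (iota 0 L).
Qed.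

Lemma computable_S x : computable x -> computable (fun L e => (x L e).+1).
Proof.
move=> hx; apply: (eq_computable (computable_add hx (computable_const 1))).
by move=> L e; rewrite addn1.
Qed.

(** With truncated subtraction, [1 - (x - y)] is the truth value of the comparison. *)
Lemma decides_leq x y : computable x -> computable y ->
  decides (fun L e => x L e <= y L e).
Proof.
move=> hx hy.
apply: (eq_computable (computable_sub (computable_const 1) (computable_sub hx hy))).
by move=> L e; case: leqP => h /=; lia.
Qed.

Lemma decides_ltn x y : computable x -> computable y ->
  decides (fun L e => x L e < y L e).
Proof. by move=> hx hy; apply: decides_leq => //; apply: computable_S. Qed.

Lemma decides_neg P : decides P -> decides (fun L e => ~~ P L e).
Proof.
move=> hP; apply: (eq_computable (computable_sub (computable_const 1) hP)).
by move=> L e; case: (P L e).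
Qed.

Lemma decides_if P Q R : decides P -> decides Q -> decides R ->
  decides (fun L e => if P L e then Q L e else R L e).
Proof.
move=> hP hQ hR; apply: (eq_computable (computable_if hP hQ hR)) => L e.
by case: (P L e).
Qed.

Lemma decides_and P Q : decides P -> decides Q ->
  decides (fun L e => P L e && Q L e).
Proof.
move=> hP hQ.
exact: (decides_if hP hQ (computable_const 0 : decides (fun _ _ => false))).
Qed.

Lemma decides_imply P Q : decides P -> decides Q ->
  decides (fun L e => P L e ==> Q L e).
Proof.
move=> hP hQ.
exact: (decides_if hP hQ (computable_const 1 : decides (fun _ _ => true))).
Qed.

Lemma decides_add P Q : decides P -> decides Q ->
  decides (fun L e => P L e (+) Q L e).
Proof.
move=> hP hQ; apply: (eq_computable (decides_if hP (decides_neg hQ) hQ)) => L e.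
by case: (P L e).
Qed.

Lemma decides_neq x y : computable x -> computable y ->
  decides (fun L e => x L e != y L e).
Proof.
move=> hx hy; apply: (eq_computable (decides_neg
  (decides_and (decides_leq hx hy) (decides_leq hy hx)))) => L e.
by rewrite -eqn_leq.
Qed.

Lemma decides_all P : decides (fun L e => P L (e 0) (fun j => e j.+1)) ->
  decides (fun L e => all (fun i => P L i e) (iota 0 L)).
Proof.
move=> hP; have h1 : decides (fun L e =>
    (0 < e 1) && P L (e 0) (fun j => e j.+2)).
  apply: decides_and; first exact: decides_ltn (computable_const 0) (computable_var 1).
  (* The predicate does not see the accumulator, so the renaming skips variable 1. *)
  exact: (computable_rename (fun j => if j is j'.+1 then j'.+2 else 0) hP).
apply: (eq_computable (@computable_loop _
  (fun L i acc e => (0 < acc) && P L i e) (computable_const 1) h1)) => L e.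
have aux l : iteri l (fun i acc => nat_of_bool ((0 < acc) && P L i e)) 1 =
    all (fun i => P L i e) (iota 0 l).
  elim: l => // l IH; rewrite [LHS]/= IH -[in RHS]addn1 iotaD all_cat /= andbT add0n.
  by case: all.
exact: aux.
Qed.

Lemma computable_iter_upto x y f : computable x -> computable y ->
  computable (fun L e => f L (e 0) (fun j => e j.+1)) ->
  computable (fun L e => iter_upto L (x L e) (fun acc => f L acc e) (y L e)).
Proof.
move=> hx hy hf.
apply: (@computable_loop y (fun L i acc e =>
  if i < x L e then f L acc e else acc)) => //.
apply: computable_if; last exact: computable_var.
  by apply: decides_ltn; [exact: computable_var |];
    exact: (computable_rename (fun j => j.+2) hx).
exact: computable_shift hf.
Qed.

Ltac comp_hyp :=
  match goal with H : computable _ |- computable _ =>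
    first [exact H | exact (computable_rename (fun j => j.+1) H)
          | exact (computable_rename (fun j => j.+2) H)
          | exact (computable_rename (fun j => j.+3) H)
          | exact (computable_rename (fun j => j.+4) H)] end.

Ltac comp_step := cbv beta;
  lazymatch goal with
  | |- decides (fun L e => andb _ _) => apply: decides_and
  | |- decides (fun L e => implb _ _) => apply: decides_imply
  | |- decides (fun L e => addb _ _) => apply: decides_add
  | |- decides (fun L e => ~~ (_ == _)) => apply: decides_neq
  | |- decides (fun L e => ~~ _) => apply: decides_neg
  | |- decides (fun L e => _.+1 <= _) => apply: decides_ltn
  | |- decides (fun L e => _ <= _) => apply: decides_leq
  | |- decides (fun L e => all _ (iota 0 L)) => apply: decides_all
  | |- computable (fun L e => e _) => exact: computable_var
  | |- computable (fun L e => if _ then _ else _) => apply: computable_if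
  | |- computable (fun L e => addn _ _) => apply: computable_add
  | |- computable (fun L e => subn _ _) => apply: computable_sub
  | |- computable (fun L e => S _) => apply: computable_S
  | |- computable (fun L e => iter_upto L _ _ _) => apply: computable_iter_upto
  | _ => first [exact: computable_const | comp_hyp]
  end.

Lemma computable_shift_out Q u : computable Q -> computable u ->
  computable (fun L e => shift_out (Q L e) (u L e)).
Proof. by move=> hQ hu; rewrite /shift_out; repeat comp_step. Qed.

Lemma decides_msbit Q u : computable Q -> computable u ->
  decides (fun L e => msbit (Q L e) (u L e)).
Proof. by move=> hQ hu; rewrite /msbit; repeat comp_step. Qed.

Lemma decides_bit Q u r : computable Q -> computable u -> computable r ->
  decides (fun L e => bit L (Q L e) (u L e) (r L e)).
Proof.
move=> hQ hu hr; apply: decides_msbit => //.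
by apply: computable_iter_upto => //; apply: computable_shift_out; comp_step.
Qed.

Lemma computable_taps_parity Q k c u : computable Q -> computable k ->
  computable c -> computable u ->
  computable (fun L e => taps_parity L (Q L e) (k L e) (c L e) (u L e)).
Proof.
move=> hQ hk hc hu; rewrite /taps_parity.
apply: (@computable_loop (fun _ _ => 0) (fun L r acc e =>
  if [&& r < k L e, bit L (Q L e) (c L e) r & bit L (Q L e) (u L e) r]
  then 1 - acc else acc)); first exact: computable_const.
apply: computable_if; [|by repeat comp_step..].
by apply: decides_and; [|apply: decides_and; apply: decides_bit];
  repeat comp_step.
Qed.

Lemma computable_lfsr_next Q k c u : computable Q -> computable k ->
  computable c -> computable u ->
  computable (fun L e => lfsr_next L (Q L e) (k L e) (c L e) (u L e)).
Proof.
move=> hQ hk hc hu; apply: computable_add; first exact: computable_shift_out.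
exact: computable_taps_parity.
Qed.

Lemma decides_lfsr Q k c j : computable Q -> computable k ->
  computable c -> computable j ->
  decides (fun L e => lfsr L (Q L e) (k L e) (c L e) (j L e)).
Proof.
move=> hQ hk hc hj; apply: decides_msbit => //.
apply: computable_iter_upto => //; first exact: computable_const.
by apply: computable_lfsr_next; repeat comp_step.
Qed.

Lemma decides_vanish Q k c x1 x2 x3 x4 : computable Q -> computable k ->
  computable c -> computable x1 -> computable x2 -> computable x3 ->
  computable x4 ->
  decides (fun L e => vanish L (k L e) (lfsr L (Q L e) (k L e) (c L e))
    (x1 L e) (x2 L e) (x3 L e) (x4 L e)).
Proof.
move=> hQ hk hc h1 h2 h3 h4; rewrite /vanish.
apply: (@decides_all (fun L r e => (r < k L e) ==>
  ~~ (lfsr L (Q L e) (k L e) (c L e) (x1 L e + r) (+)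
      lfsr L (Q L e) (k L e) (c L e) (x2 L e + r) (+)
      lfsr L (Q L e) (k L e) (c L e) (x3 L e + r) (+)
      lfsr L (Q L e) (k L e) (c L e) (x4 L e + r)))).
apply: decides_imply; first by repeat comp_step.
by apply: decides_neg; do 3?apply: decides_add; apply: decides_lfsr;
  repeat comp_step.
Qed.

Lemma decides_separating N Q k c : computable N -> computable Q ->
  computable k -> computable c ->
  decides (fun L e => separating L (N L e) (k L e)
    (lfsr L (Q L e) (k L e) (c L e))).
Proof.
move=> hN hQ hk hc; rewrite /separating.
do 4!comp_step; apply: decides_imply; first by repeat comp_step.
apply: decides_and.
  by apply: decides_neg; apply: decides_vanish; repeat comp_step.
apply: decides_imply; first by repeat comp_step.
by apply: decides_neg; apply: decides_vanish; repeat comp_step.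
Qed.

(** * Computation of the parameters and enumeration of the edges *)

Definition pow2 (L k : nat) : nat := iter_upto L k (fun a => a + a) 1.
Definition pow3 (L l : nat) : nat := iter_upto L l (fun a => a + a + a) 1.
Definition times (L b x : nat) : nat := iter_upto L b (fun a => a + x) 0.

(* The least [i < L] satisfying [P], and [L] if there is none. *)
Definition search (L : nat) (P : pred nat) : nat :=
  iteri L (fun _ acc => if P acc then acc else acc.+1) 0.

Definition degree (L N : nat) : nat := search L (fun k => N < pow2 L k).

Definition taps (L N : nat) : nat :=
  search L (fun c => separating L N (degree L N)
    (lfsr L (pow2 L (degree L N)) (degree L N) c)).

Definition level_lfsr (L N : nat) : nat -> bool :=
  lfsr L (pow2 L (degree L N)) (degree L N) (taps L N).

(** The components are the level [l], giving parts of size [N = 3 ^ l], the number [b] of the block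
    among those of its level, and the positions [i, i', j, j', z] of the five vertices inside their
    parts. *)
Definition param : Type := nat * (nat * (nat * (nat * (nat * (nat * nat))))).

Definition edge_verts (L : nat) (p : param) : seq nat :=
  let: (l, (b, (i, (i', (j, (j', z)))))) := p in
  let N := pow3 L l in let base := times L b (N + N + N) in
  [:: base + i; base + i'; base + N + j; base + N + j'; base + N + N + z].

(** The orders [i < i'] and [j < j'] select one parameter per edge. The vertex of [z] is the largest
    of the five, so comparing it with [n] discards exactly the edges that leave the vertex set. *)
Definition edge_cond (L n : nat) (p : param) : bool :=
  let: (l, (b, (i, (i', (j, (j', z)))))) := p in
  let N := pow3 L l in let base := times L b (N + N + N) in
  [&& i < i', i' < N, j < j', j' < N, z < N, base + N + N + z < n &
      vanish L (degree L N) (level_lfsr L N) (z + i) (z + i') j j'].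

Definition params (L : nat) : seq param :=
  let prod {T : Type} := fun s : seq T => [seq (x, y) | x <- iota 0 L, y <- s] in
  prod (prod (prod (prod (prod (prod (iota 0 L)))))).

Definition edge_list (L n : nat) : seq (seq nat) :=
  [seq edge_verts L p | p <- params L & edge_cond L n p].

Lemma computable_pow2 k : computable k ->
  computable (fun L e => pow2 L (k L e)).
Proof. by move=> hk; rewrite /pow2; repeat comp_step. Qed.

Lemma computable_pow3 l : computable l ->
  computable (fun L e => pow3 L (l L e)).
Proof. by move=> hl; rewrite /pow3; repeat comp_step. Qed.

Lemma computable_times b x : computable b -> computable x ->
  computable (fun L e => times L (b L e) (x L e)).
Proof. by move=> hb hx; rewrite /times; repeat comp_step. Qed.

Lemma computable_search P : decides (fun L e => P L (e 0) (fun j => e j.+1)) ->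
  computable (fun L e => search L (fun i => P L i e)).
Proof.
move=> hP; rewrite /search; apply: (@computable_loop (fun _ _ => 0)
  (fun L _ acc e => if P L acc e then acc else acc.+1)).
  exact: computable_const.
apply: computable_if; [exact: decides_shift hP | by repeat comp_step..].
Qed.

Lemma computable_degree N : computable N ->
  computable (fun L e => degree L (N L e)).
Proof.
move=> hN; apply: (@computable_search (fun L k e => N L e < pow2 L k)).
by apply: decides_ltn; [|apply: computable_pow2]; comp_step.
Qed.

Lemma computable_taps N : computable N ->
  computable (fun L e => taps L (N L e)).
Proof.
move=> hN; apply: (@computable_search (fun L c e =>
  separating L (N L e) (degree L (N L e))
    (lfsr L (pow2 L (degree L (N L e))) (degree L (N L e)) c))).
have hN' := computable_shift hN; have hk := computable_degree hN'.
apply: (decides_separating (N := fun L e => N L (fun j => e j.+1)) hN'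
  (computable_pow2 hk) hk (computable_var 0)).
Qed.

Lemma emits_loop G : emits (fun L e => G L (e 0) (fun j => e j.+2)) ->
  emits (fun L e => flatten [seq G L i e | i <- iota 0 L]).
Proof.
move=> hG; apply: (eq_proc (proc_seq (@proc_loop (fun _ _ => 0)
  (fun _ _ _ _ => 0) G (computable_const 0) hG) (computable_const 0))) => // L e.
by rewrite cats0.
Qed.

Lemma emits_cons x G : computable x -> emits G ->
  emits (fun L e => x L e :: G L e).
Proof. by move=> hx hG; apply: (proc_seq (proc_emit hx) hG). Qed.

Lemma emits_if P G : decides P -> emits G ->
  emits (fun L e => if P L e then G L e else [::]).
Proof.
move=> hP hG; apply: (eq_proc (proc_if hP hG (computable_const 0))) => // L e.
by case: (P L e).
Qed.

Lemma emits_edge l b i i' j j' z n : computable l -> computable b ->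
  computable i -> computable i' -> computable j -> computable j' ->
  computable z -> computable n ->
  emits (fun L e =>
    let p := (l L e, (b L e, (i L e, (i' L e, (j L e, (j' L e, z L e)))))) in
    if edge_cond L (n L e) p then edge_verts L p else [::]).
Proof.
move=> hl hb hi hi' hj hj' hz hn; have hN := computable_pow3 hl.
have hB := computable_times hb (computable_add (computable_add hN hN) hN).
have hk := computable_degree hN.
rewrite /edge_cond /edge_verts; apply: emits_if.
  do 6!(apply: decides_and; first by repeat comp_step).
  rewrite /level_lfsr; apply: decides_vanish => //.
  - exact: computable_pow2.
  - exact: computable_taps.
  - exact: computable_add.
  - exact: computable_add.
by do 5!(apply: emits_cons; first by repeat comp_step); apply: computable_const.
Qed.

(** Turns the output over a product into two nested loops, the form that [emits_loop] produces. *)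
Lemma flatten_map_allpairs (S T : Type) (f : S * T -> seq nat) s t :
  flatten [seq f p | p <- [seq (x, y) | x <- s, y <- t]] =
  flatten [seq flatten [seq f (x, y) | y <- t] | x <- s].
Proof.
elim: s => //= x s IH; rewrite map_cat flatten_cat IH.
by rewrite -map_comp.
Qed.

Lemma flatten_edge_list L n : flatten (edge_list L n) =
  flatten [seq (if edge_cond L n p then edge_verts L p else [::]) | p <- params L].
Proof.
rewrite /edge_list; elim: (params L) => //= p s <-.
by case: (edge_cond L n p).
Qed.

Lemma emits_edge_list :
  emits (fun L e => flatten (edge_list L (e 0))).
Proof.
have h : emits (fun L e =>
    flatten [seq flatten [seq flatten [seq flatten [seq flatten [seq
    flatten [seq flatten [seq
      (let p := (l, (b, (i, (i', (j, (j', z)))))) in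
       if edge_cond L (e 0) p then edge_verts L p else [::])
    | z <- iota 0 L] | j' <- iota 0 L] | j <- iota 0 L] | i' <- iota 0 L]
    | i <- iota 0 L] | b <- iota 0 L] | l <- iota 0 L]).
  do 7!(apply: emits_loop; cbv beta).
  by apply: emits_edge; apply: computable_var.
apply: (eq_proc h) => // L e; rewrite flatten_edge_list /params.
do 6!(rewrite flatten_map_allpairs; congr flatten; apply: eq_map => ?).
Qed.

Lemma edge_list_program : exists (p : program) (a b k : nat), forall n,
  exists t, computes p n (flatten (edge_list (4 * n + 4) n)) t /\
            t <= a * n ^ k + b.
Proof.
have [p [c [k h]]] := emits_edge_list (isT : 0 < 2) (fun _ : nat => isT : 1 < 2).
(* The prelude of six instructions saves [n] in register 1 and puts the loop bound [4 * n + 4] in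
   register 0; register 2 is the first one free. *)
exists (Seq (Const 1 0) (Seq (Add 1 0 1) (Seq (Add 0 0 0) (Seq (Add 0 0 0)
  (Seq (Const 2 4) (Seq (Add 0 0 2) p)))))).
(* The base of the time bound is [4 * n + 5], which is at most [9 * n] for positive [n] and at most
   9 for [n = 0]. The 6 counts the prelude. *)
exists (c * 9 ^ k), (c * 9 ^ k + 6), k => n.
pose m0 : memory := update (fun=> 0) 0 n.
pose m1 := update m0 1 0.
pose m2 := update m1 1 (m1 0 + m1 1).
pose m3 := update m2 0 (m2 0 + m2 0).
pose m4 := update m3 0 (m3 0 + m3 0).
pose m5 := update m4 2 4.
pose m6 := update m5 0 (m5 0 + m5 2).
have [m' [t [x _ _ b]]] := h m6 [::].
have e0 : m6 0 = 4 * n + 4.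
  by rewrite /m6 /m5 /m4 /m3 /m2 /m1 /m0 /update /=; lia.
have e1 : m6 1 = n by rewrite /m6 /m5 /m4 /m3 /m2 /m1 /m0 /update /= addn0.
rewrite /= e0 e1 in x b.
exists (1 + (1 + (1 + (1 + (1 + (1 + t)))))); split.
  exists m'; apply: exec_seq; first exact: exec_const.
  apply: exec_seq; first exact: exec_add.
  apply: exec_seq; first exact: exec_add.
  apply: exec_seq; first exact: exec_add.
  apply: exec_seq; first exact: exec_const.
  by apply: exec_seq; first exact: exec_add.
suff : t <= c * 9 ^ k * n ^ k + c * 9 ^ k by lia.
apply: leq_trans b _; rewrite -mulnA -expnMn.
case: n {x e0 e1 m0 m1 m2 m3 m4 m5 m6 m'} => [|n].
  apply: leq_trans (leq_addl _ _).
  by rewrite leq_mul2l; apply/orP; right; case: k {h} => // k; rewrite leq_exp2r.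
apply: leq_trans (leq_addr _ _).
rewrite leq_mul2l; apply/orP; right; case: k {h} => // k.
by rewrite leq_exp2r //; lia.
Qed.

(** * The system *)

Lemma pow2E L k : k <= L -> pow2 L k = 2 ^ k.
Proof.
move=> kL; rewrite /pow2 iter_uptoE //.
by elim: k {kL} => //= k ->; rewrite expnS; lia.
Qed.

Lemma pow3E L l : l <= L -> pow3 L l = 3 ^ l.
Proof.
move=> lL; rewrite /pow3 iter_uptoE //.
by elim: l {lL} => //= l ->; rewrite expnS; lia.
Qed.

Lemma timesE L b x : b <= L -> times L b x = b * x.
Proof.
move=> bL; rewrite /times iter_uptoE //.
by elim: b {bL} => //= b ->; rewrite mulSn addnC.
Qed.

Lemma searchP L (P : pred nat) i : i < L -> P i ->
  [/\ P (search L P), search L P <= i & forall j, j < search L P -> ~~ P j].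
Proof.
move=> iL Pi; rewrite /search.
set f := fun _ _ => _; set r := iteri L f 0.
have [h1 h2] : (forall j, j < r -> ~~ P j) /\ (P r \/ r = L).
  rewrite /r; elim: (L) => [|l [IH1 IH2]] /=; first by split=> //; right.
  rewrite {1 3 5}/f; case Pl: (P _); first by split=> //; left.
  split; last by right; case: IH2 => [|->]; rewrite ?Pl.
  by move=> j; rewrite ltnS leq_eqVlt => /orP[/eqP->|/IH1//]; rewrite Pl.
have ri : r <= i by case: leqP => // /h1; rewrite Pi.
by split=> //; case: h2 => // rL; lia.
Qed.

Lemma degreeP L N : 0 < N -> N < L ->
  [/\ degree L N <= N, N < 2 ^ degree L N & 2 ^ degree L N <= N.*2].
Proof.
move=> N0 NL; rewrite /degree.
(* The search succeeds by [N] at the latest, since [N < 2 ^ N]. *)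
have [|] := @searchP L (fun k => N < pow2 L k) N NL.
  by rewrite pow2E ?(ltnW NL) // ltn_expl.
set k := search _ _ => h1 h2 h3; rewrite pow2E in h1; last by lia.
split=> //; case: k h2 h3 h1 => [|k] h2 h3 h1; first by rewrite expn0; lia.
have := h3 k (ltnSn k); rewrite pow2E; last by lia.
by rewrite -leqNgt expnS; lia.
Qed.

(** The degree [k] satisfies [k <= N] and [2 ^ k <= 2N], so [4 * N <= L] leaves room for all the
    bounds required to find taps. *)
Lemma separating_level L N : 0 < N -> 4 * N <= L ->
  separating L N (degree L N) (level_lfsr L N).
Proof.
move=> N0 NL; have [|h1 h2 h3] := @degreeP L N N0; first by lia.
rewrite /level_lfsr pow2E; last by lia.
have [|||||c cL sep] := @exists_taps L N (degree L N); rewrite -?muln2 in h3 *; try lia.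
have [] := @searchP L (fun c => separating L N (degree L N)
    (lfsr L (2 ^ degree L N) (degree L N) c)) c cL sep.
by rewrite /taps pow2E //; lia.
Qed.

(** * Intersections of edges *)

Section Edges.
Variable n : nat.
Local Notation L := (4 * n + 4).

Definition in_range (p : param) : bool :=
  let: (l, (b, (i, (i', (j, (j', z)))))) := p in
  [&& l < L, b < L, i < L, i' < L, j < L, j' < L & z < L].

Lemma mem_allpairs_pair (S T : eqType) (s : seq S) (t : seq T) x y :
  ((x, y) \in [seq (x, y) | x <- s, y <- t]) = (x \in s) && (y \in t).
Proof.
apply/allpairsP/andP => [[[x' y'] /= [? ? [-> ->]]] //|[xs yt]].
by exists (x, y).
Qed.

Lemma mem_params p : (p \in params L) = in_range p.
Proof.
case: p => l [b [i [i' [j [j' z]]]]].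
by rewrite /params !mem_allpairs_pair !mem_iota !add0n.
Qed.

Lemma uniq_params : uniq (params L).
Proof.
rewrite /params; do 6?[apply: allpairs_uniq => //; rewrite ?iota_uniq //].
all: try by move=> [? ?] [? ?] _ _ [-> ->].
Qed.

(** Block [b] of level [l] consists of the intervals of length [3 ^ l] numbered [3b], [3b + 1] and
    [3b + 2], which are its three parts. *)
Definition block_verts (p : param) : seq nat :=
  let: (l, (b, (i, (i', (j, (j', z)))))) := p in
  [:: 3 * b * 3 ^ l + i; 3 * b * 3 ^ l + i';
      (3 * b + 1) * 3 ^ l + j; (3 * b + 1) * 3 ^ l + j';
      (3 * b + 2) * 3 ^ l + z].

Lemma edge_vertsE p : in_range p -> edge_verts L p = block_verts p.
Proof.
case: p => l [b [i [i' [j [j' z]]]]] /= /and5P[lL bL _ _ _].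
rewrite pow3E ?timesE; try lia.
by do ![congr (_ :: _); first by lia].
Qed.

Definition van (l : nat) := vanish L (degree L (3 ^ l)) (level_lfsr L (3 ^ l)).

Lemma edge_condE l b i i' j j' z :
  in_range (l, (b, (i, (i', (j, (j', z)))))) ->
  edge_cond L n (l, (b, (i, (i', (j, (j', z)))))) =
  [&& i < i', i' < 3 ^ l, j < j', j' < 3 ^ l, z < 3 ^ l,
      (3 * b + 2) * 3 ^ l + z < n & van l (z + i) (z + i') j j'].
Proof.
case/and5P=> lL bL _ _ _; rewrite /edge_cond pow3E ?timesE; try lia.
by have -> : b * (3 ^ l + 3 ^ l + 3 ^ l) + 3 ^ l + 3 ^ l + z =
  (3 * b + 2) * 3 ^ l + z by lia.
Qed.

Lemma sep_level l : 3 ^ l < n ->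
  separating L (3 ^ l) (degree L (3 ^ l)) (level_lfsr L (3 ^ l)) /\
  degree L (3 ^ l) <= L.
Proof.
move=> ln; have l0 : 0 < 3 ^ l by rewrite expn_gt0.
split; first by apply: separating_level => //; lia.
by have [|] := @degreeP L (3 ^ l) l0; lia.
Qed.

Definition valid_param (p : param) : bool := in_range p && edge_cond L n p.

Lemma valid_paramP l b i i' j j' z :
  valid_param (l, (b, (i, (i', (j, (j', z)))))) ->
  [/\ i < i' < 3 ^ l, j < j' < 3 ^ l, z < 3 ^ l,
      (3 * b + 2) * 3 ^ l + z < n & van l (z + i) (z + i') j j'].
Proof.
by case/andP=> r; rewrite edge_condE // => /and5P[-> -> -> -> /and3P[-> -> ->]].
Qed.

Lemma count5 (P : pred nat) x1 x2 x3 x4 x5 :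
  count P [:: x1; x2; x3; x4; x5] = P x1 + P x2 + P x3 + P x4 + P x5.
Proof. by rewrite /= addn0 !addnA. Qed.

(** The parts are disjoint, so a vertex can only coincide with a vertex of the other edge in the
    same part. *)
Lemma same_block_count l b i i' j j' z i2 i2' j2 j2' z2
    (p := (l, (b, (i, (i', (j, (j', z)))))))
    (q := (l, (b, (i2, (i2', (j2, (j2', z2))))))) :
  valid_param p -> valid_param q ->
  count [in block_verts q] (block_verts p) =
    ((i == i2) || (i == i2')) + ((i' == i2) || (i' == i2')) +
    ((j == j2) || (j == j2')) + ((j' == j2) || (j' == j2')) + (z == z2).
Proof.
move=> /valid_paramP[h1 h2 h3 _ _] /valid_paramP[g1 g2 g3 _ _].
rewrite /p /q /block_verts; move: (3 ^ l) h1 h2 h3 g1 g2 g3 => N.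
rewrite !mulnDl mul1n mul2n -addnn; move: (3 * b * N) => B h1 h2 h3 g1 g2 g3.
rewrite count5 !inE; do ![congr (_ + _)]; lia.
Qed.

(** Adding the equations of the two edges cancels the common terms, and [separating] excludes what
    would remain if the fifth vertices differed. *)
Lemma same_block_eq p q : valid_param p -> valid_param q ->
  p.1 = q.1 -> p.2.1 = q.2.1 ->
  3 < count [in block_verts q] (block_verts p) -> p = q.
Proof.
case: p q => l [b [i [i' [j [j' z]]]]] [l2 [b2 [i2 [i2' [j2 [j2' z2]]]]]].
move=> gp gq e1 e2; rewrite /= in e1 e2; subst l2 b2.
rewrite same_block_count //.
move/valid_paramP: gp => [h1 h2 h3 h4 h5].
move/valid_paramP: gq => [g1 g2 g3 g4 g5].
have ln : 3 ^ l < n by move: (3 ^ l) h1 h4 => [|N]; lia.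
have [sep kL] := sep_level ln.
have /separatingP {}sep := sep; have {}sep := sep (ltac:(lia)).
have l0 : 0 < 3 ^ l by lia.
have inj0 w w' : w < 3 ^ l -> w' < 3 ^ l -> van l w w' 0 0 -> w = w'.
  move=> hw hw' v; apply/eqP; apply/negPn/negP => ww'.
  by have [/negP[]] := sep 0 0 _ _ l0 l0 hw hw' ww'.
have injz w w' : w < 3 ^ l -> w' < 3 ^ l -> van l (z + w) (z + w') 0 0 -> w = w'.
  move=> hw hw' v; apply/eqP; apply/negPn/negP => ww'.
  by have [/negP[]] := sep z z _ _ h3 h3 hw hw' ww'.
have hj y w y' w' : (y == y') -> w < 3 ^ l -> w' < 3 ^ l ->
    van l (z + i) (z + i') y w -> van l (z + i) (z + i') y' w' -> w = w'.
  by move=> /eqP<- hw hw' v v'; apply: inj0 => //; apply: vanish_cancelr v v'.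
have hi y w y' w' : (y == y') -> w < 3 ^ l -> w' < 3 ^ l ->
    van l (z + y) (z + w) j j' -> van l (z + y') (z + w') j j' -> w = w'.
  by move=> /eqP<- hw hw' v v'; apply: injz => //; apply: vanish_cancell v v'.
(* If the third parts disagree, the other four vertices coincide, and the sum of the equations is
   [(g^z + g^z2) (g^i + g^i') = 0]. *)
have [zz|zz] := eqVneq z z2; last first.
  move=> cnt; have [[ei ei'] [ej ej']] :
    (i = i2 /\ i' = i2') /\ (j = j2 /\ j' = j2') by lia.
  subst i2 i2' j2 j2'.
  have [_ /(_ zz)/negP[]] := sep z z2 i i' h3 g3 ltac:(lia) ltac:(lia) ltac:(lia).
  exact: vanish_trans h5 g5.
subst z2 => cnt.
have [[ei ei']|[ej ej']] : (i = i2 /\ i' = i2') \/ (j = j2 /\ j' = j2') by lia.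
  subst i2 i2'.
  have /or4P[e|e|e|e] : [|| j == j2, j == j2', j' == j2 | j' == j2'] by lia.
  - have ? := hj _ j' _ j2' e ltac:(lia) ltac:(lia) h5 g5.
    by move/eqP: e => e; subst j2 j2'.
  (* A crossed match [j = j2'] would give [j' = j2], against [j < j'] and [j2 < j2']. *)
  - rewrite /van vanishCr in g5.
    by have ? := hj _ j' _ j2 e ltac:(lia) ltac:(lia) h5 g5; lia.
  - rewrite /van vanishCr in h5.
    by have ? := hj _ j _ j2' e ltac:(lia) ltac:(lia) h5 g5; lia.
  - rewrite /van vanishCr in h5; rewrite /van vanishCr in g5.
    have ? := hj _ j _ j2 e ltac:(lia) ltac:(lia) h5 g5.
    by move/eqP: e => e; subst j2 j2'.
subst j2 j2'.
have /or4P[e|e|e|e] : [|| i == i2, i == i2', i' == i2 | i' == i2'] by lia.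
- have ? := hi _ i' _ i2' e ltac:(lia) ltac:(lia) h5 g5.
  by move/eqP: e => e; subst i2 i2'.
- rewrite /van vanishCl in g5.
  by have ? := hi _ i' _ i2 e ltac:(lia) ltac:(lia) h5 g5; lia.
- rewrite /van vanishCl in h5.
  by have ? := hi _ i _ i2' e ltac:(lia) ltac:(lia) h5 g5; lia.
- rewrite /van vanishCl in h5; rewrite /van vanishCl in g5.
  have ? := hi _ i _ i2 e ltac:(lia) ltac:(lia) h5 g5.
  by move/eqP: e => e; subst i2 i2'.
Qed.

Lemma block_verts_uniq p : valid_param p -> uniq (block_verts p).
Proof.
case: p => l [b [i [i' [j [j' z]]]]] /valid_paramP[h1 h2 h3 _ _].
rewrite /block_verts; move: (3 ^ l) h1 h2 h3 => N.
rewrite !mulnDl mul1n mul2n -addnn; move: (3 * b * N) => B h1 h2 h3.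
rewrite /= !inE; lia.
Qed.

Lemma block_verts_lt p v : valid_param p -> v \in block_verts p -> v < n.
Proof.
case: p => l [b [i [i' [j [j' z]]]]] /valid_paramP[h1 h2 h3 h4 _].
move: h4; rewrite /block_verts; move: (3 ^ l) h1 h2 h3 => N.
rewrite !mulnDl mul1n mul2n -addnn; move: (3 * b * N) => B h1 h2 h3 h4.
rewrite !inE; lia.
Qed.

(** A vertex and a level determine the block, so edges of the same level with a common vertex lie in
    the same block. *)
Lemma block_verts_div p v : valid_param p -> v \in block_verts p ->
  v %/ 3 ^ p.1.+1 = p.2.1.
Proof.
case: p => l [b [i [i' [j [j' z]]]]] /valid_paramP[h1 h2 h3 _ _] hv.
apply/eqP; rewrite eqn_leq -ltnS ltn_divLR ?leq_divRL ?expn_gt0 // expnS.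
rewrite [(_, _).2.1]/= [(_, _).1]/=; move: hv; rewrite /block_verts.
move: (3 ^ l) h1 h2 h3 => N h1 h2 h3.
have -> : b.+1 * (3 * N) = 3 * b * N + 3 * N by lia.
have -> : b * (3 * N) = 3 * b * N by lia.
rewrite !mulnDl mul1n mul2n -addnn !inE; lia.
Qed.

(* A block of a lower level lies in a single part of any higher block, and an
   edge has at most two vertices in each part. *)
Lemma lower_block_count p q : valid_param p -> valid_param q -> p.1 < q.1 ->
  count [in block_verts p] (block_verts q) <= 2.
Proof.
move=> gp gq lt.
(* [c] is the number of the interval of length [3 ^ q.1] that contains the whole block of [p]. *)
pose t := 3 ^ (q.1 - p.1.+1); pose c := p.2.1 %/ t.
have sub : {subset [in block_verts p] <= [pred v | v %/ 3 ^ q.1 == c]}.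
  move=> v vp; rewrite inE /c -(block_verts_div gp vp) -divnMA -expnD.
  by rewrite subnKC.
apply: leq_trans (sub_count sub _) _.
case: q gq {sub lt t c} (c : nat) => l [b [i [i' [j [j' z]]]]] gq c.
move/valid_paramP: gq => [h1 h2 h3 _ _]; rewrite /block_verts.
have N0 : 0 < 3 ^ l by lia.
rewrite count5 !inE !divnMDl // !divn_small; lia.
Qed.

Lemma count_memC (s t : seq nat) : uniq s -> uniq t ->
  count [in s] t = count [in t] s.
Proof.
move=> us ut; rewrite -!size_filter; apply/perm_size/uniq_perm.
- exact: filter_uniq.
- exact: filter_uniq.
by move=> x; rewrite !mem_filter andbC.
Qed.

Lemma block_verts_inj p q : valid_param p -> valid_param q ->
  3 < count [in block_verts q] (block_verts p) -> p = q.
Proof.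
move=> gp gq h; case: (ltngtP p.1 q.1) => l.
- have := lower_block_count gp gq l.
  by rewrite count_memC ?block_verts_uniq //; lia.
- by have := lower_block_count gq gp l; lia.
apply: same_block_eq => //.
have /hasP[v vp vq] : has [in block_verts q] (block_verts p).
  by rewrite has_count; lia.
by rewrite -(block_verts_div gp vp) -(block_verts_div gq vq) l.
Qed.

End Edges.

(** * The independence number *)

Lemma count_div3 (a : seq nat) N b : 0 < N ->
  count (fun v => v %/ (3 * N) == b) a =
  count (fun v => v %/ N == 3 * b) a + count (fun v => v %/ N == 3 * b + 1) a +
  count (fun v => v %/ N == 3 * b + 2) a.
Proof.
move=> N0; elim: a => [|v a IH]; first by [].
rewrite -![count _ (v :: a)]/(_ + count _ a) IH [3 * N]mulnC divnMA.
lia.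
Qed.

(** Since [16 * 3 <= 7 * 7], the power [(7/4)^l] dominates the square root of [3^l]. *)
Lemma small_factor l s : s * s <= 2 * 3 ^ l -> 4 ^ l * s <= 2 * 7 ^ l.
Proof.
have : 4 ^ l * 4 ^ l * 3 ^ l <= 7 ^ l * 7 ^ l.
  by rewrite -!expnMn; case: l => // l; rewrite leq_exp2r.
move: (4 ^ l) (7 ^ l) (3 ^ l) => P S T h1 h2; rewrite leqNgt; apply/negP => h3.
have h4 : (2 * S).+1 * (2 * S).+1 <= P * s * (P * s) by apply: leq_mul.
have h5 : P * P * (s * s) <= P * P * (2 * T) by rewrite leq_mul2l h2 orbT.
by nia.
Qed.

(* [8 * 7 ^ l] absorbs the error terms [sqrt (2 * 3 ^ l) <= 2 * (7 / 4) ^ l]. *)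
Lemma balance l x y w : 4 ^ l * x + 8 * 7 ^ l <= 9 * 8 ^ l ->
  4 ^ l * y + 8 * 7 ^ l <= 9 * 8 ^ l -> 4 ^ l * w + 8 * 7 ^ l <= 9 * 8 ^ l ->
  (w = 0 \/ x * y <= 2 * 3 ^ l) ->
  4 ^ l.+1 * (x + y + w) + 8 * 7 ^ l.+1 <= 9 * 8 ^ l.+1.
Proof.
move=> hx hy hw [->|xy].
  by rewrite !expnS addn0; lia.
have : 4 ^ l * x <= 2 * 7 ^ l \/ 4 ^ l * y <= 2 * 7 ^ l.
  case: (leqP x y) => c; [left|right]; apply: small_factor; nia.
(* The small factor contributes [2 * 7 ^ l], the two other parts [9 * 8 ^ l - 8 * 7 ^ l] each. The
   constants match exactly: [4 * (2 - 16) = -8 * 7]. *)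
by rewrite !expnS; move=> [h|h]; lia.
Qed.

Section Alpha.
Variable n : nat.
Local Notation L := (4 * n + 4).
Variable a : seq nat.
Hypothesis ua : uniq a.
Hypothesis an : forall v, v \in a -> v < n.
Hypothesis indep : forall p, valid_param n p -> ~~ all [in a] (block_verts p).

Definition part (N c : nat) : seq nat :=
  [seq v %% N | v <- a & v %/ N == c].

Lemma size_part N c : size (part N c) = count (fun v => v %/ N == c) a.
Proof. by rewrite size_map size_filter. Qed.

Lemma mem_part N c i : i \in part N c -> c * N + i \in a.
Proof.
case/mapP=> v; rewrite mem_filter => /andP[/eqP <- va] ->.
by rewrite -divn_eq.
Qed.

Lemma uniq_part N c : uniq (part N c).
Proof.
rewrite map_inj_in_uniq ?filter_uniq // => v w.
rewrite !mem_filter => /andP[/eqP hv _] /andP[/eqP hw _] e.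
by rewrite (divn_eq v N) (divn_eq w N) hv hw e.
Qed.

Lemma part_lt N c : 0 < N -> all (gtn N) (part N c).
Proof. by move=> N0; apply/allP => _ /mapP[v _ ->]; rewrite /= ltn_mod. Qed.

(** A vertex [z] of the third part serves as the fixed vertex of the pigeonhole argument; a solution
    of the equation would be an edge inside the set. *)
Lemma part_product l b : 3 ^ l < n -> part (3 ^ l) (3 * b + 2) != [::] ->
  size (part (3 ^ l) (3 * b)) * size (part (3 ^ l) (3 * b + 1)) <= 2 * 3 ^ l.
Proof.
move=> ln; case E: (part _ (3 * b + 2)) => [//|z s] _.
have N0 : 0 < 3 ^ l by rewrite expn_gt0.
have zp : z \in part (3 ^ l) (3 * b + 2) by rewrite E mem_head.
have za := mem_part zp; have zn := an za.
have zN : z < 3 ^ l by have /allP/(_ z zp) := part_lt (3 * b + 2) N0.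
have [sep kL] := sep_level ln.
have [||_ _ hk] := @degreeP L (3 ^ l); try lia.
rewrite mul2n; apply: leq_trans hk.
apply: (pigeonhole kL (_ : 3 ^ l <= L) sep zN); rewrite ?uniq_part ?part_lt //.
  by lia.
move=> i i' j j' hi hi' hj hj' ii jj; apply/negP => v.
have /allP/(_ _ hi')/= iN := part_lt (3 * b) N0.
have /allP/(_ _ hj')/= jN := part_lt (3 * b + 1) N0.
(* Level and block number must lie below [L], so that the edge is among those enumerated. *)
have lN : l < 3 ^ l by rewrite ltn_expl.
have bn : b < n by nia.
have r : in_range n (l, (b, (i, (i', (j, (j', z)))))).
  by rewrite /in_range; lia.
have g : valid_param n (l, (b, (i, (i', (j, (j', z)))))).
  rewrite /valid_param r edge_condE // ii jj zN zn.
  by move: iN jN => -> ->.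
by case/negP: (indep g); rewrite /block_verts /all /= !mem_part.
Qed.

(** Divided by [4 ^ l], the bound reads [9 * 2 ^ l - 8 * (7/4) ^ l]; subtracting the second term
    lets the induction close. At level 0 it is the bound 1 for a single vertex. *)
Lemma block_count l b : 3 ^ l < 3 * n ->
  4 ^ l * count (fun v => v %/ 3 ^ l == b) a + 8 * 7 ^ l <= 9 * 8 ^ l.
Proof.
elim: l b => [|l IH] b ln.
  rewrite !expn0 !mul1n !muln1 (_ : 9 = 1 + 8) // leq_add2r.
  rewrite (@eq_count _ _ (pred1 b)) => [|v]; last by rewrite /= divn1.
  by rewrite count_uniq_mem //; case: (_ \in _).
have N0 : 0 < 3 ^ l by rewrite expn_gt0.
have ln' : 3 ^ l < n by rewrite expnS in ln; lia.
rewrite [3 ^ l.+1]expnS count_div3 //; apply: balance; try by apply: IH; lia.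
rewrite -!size_part; have [e|e] := eqVneq (part (3 ^ l) (3 * b + 2)) [::].
  by left; rewrite e.
by right; apply: part_product.
Qed.

(** All vertices lie in the interval number 0 of length [3 ^ l]. *)
Lemma independent_size l : n <= 3 ^ l -> 3 ^ l < 3 * n -> size a <= 9 * 2 ^ l.
Proof.
move=> nl ln; have h := block_count 0 ln.
have e : count (fun v => v %/ 3 ^ l == 0) a = size a.
  apply/eqP; rewrite -all_count; apply/allP => v va.
  by rewrite divn_small //; apply: leq_trans (an va) nl.
rewrite e (_ : 8 = 4 * 2) // expnMn in h.
have p : 0 < 4 ^ l by rewrite expn_gt0.
by rewrite -(leq_pmul2l p); lia.
Qed.

End Alpha.

(** * The hypergraph and the list of its edges *)

Section Hypergraph.
Variable n : nat.
Local Notation L := (4 * n + 4).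

Definition edge_set (p : param) : {set 'I_n} :=
  [set v | val v \in block_verts p].

Definition edge_params : seq param := [seq p <- params L | edge_cond L n p].

Lemma mem_edge_params p : (p \in edge_params) = valid_param n p.
Proof. by rewrite mem_filter mem_params andbC. Qed.

Definition system : {set {set 'I_n}} := [set S in map edge_set edge_params].

Lemma mem_system p : valid_param n p -> edge_set p \in system.
Proof. by move=> gp; rewrite inE map_f // mem_edge_params. Qed.

Lemma card_edge_setI p q : valid_param n p ->
  #|edge_set p :&: edge_set q| = count [in block_verts q] (block_verts p).
Proof.
move=> gp; rewrite -size_filter cardE -(size_map val).
apply/perm_size/uniq_perm; rewrite ?(map_inj_uniq val_inj) ?enum_uniq //.
  by apply: filter_uniq; apply: block_verts_uniq gp.
move=> v; rewrite mem_filter; apply/mapP/andP => [[w]|[vq vp]].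
  by rewrite mem_enum !inE => /andP[wp wq] ->.
have vn := block_verts_lt gp vp.
by exists (Ordinal vn) => //; rewrite mem_enum !inE vp vq.
Qed.

Lemma size_block_verts p : size (block_verts p) = 5.
Proof. by case: p => l [b [i [i' [j [j' z]]]]]. Qed.

Lemma card_edge_set p : valid_param n p -> #|edge_set p| = 5.
Proof.
move=> gp; rewrite -(setIid (edge_set p)) card_edge_setI //.
by apply/eqP; rewrite -[5](size_block_verts p) -all_count; apply/allP.
Qed.

Lemma edge_set_inj p q : valid_param n p -> valid_param n q ->
  3 < #|edge_set p :&: edge_set q| -> p = q.
Proof.
by move=> gp gq; rewrite card_edge_setI //; apply: (block_verts_inj gp gq).
Qed.

Lemma system_is_system : 5 <= n -> is_system 5 4 system.
Proof.
move=> n5; split=> // [E|E F]; rewrite inE => /mapP[p].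
  by rewrite mem_edge_params => gp ->; apply: card_edge_set.
rewrite mem_edge_params => gp ->; rewrite inE => /mapP[q].
rewrite mem_edge_params => gq -> /eqP neq; rewrite ltnNge; apply/negP => h.
by apply: neq; rewrite (edge_set_inj gp gq h).
Qed.

(** Equal edges meet in five vertices, so the bound on intersections also shows that no edge is
    listed twice. *)
Lemma map_edge_set_uniq : uniq (map edge_set edge_params).
Proof.
rewrite map_inj_in_uniq ?filter_uniq ?uniq_params // => p q.
rewrite !mem_edge_params => gp gq e; apply: (edge_set_inj gp gq).
by rewrite -e setIid (card_edge_set gp).
Qed.

Lemma system_listed : lists_edges 5 (flatten (edge_list L n)) system.
Proof.
have [n0|n0] := posnP n.
  exists [::]; split.
    rewrite /edge_list -/edge_params; case E: edge_params => [//|p s].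
    have : valid_param n p by rewrite -mem_edge_params E mem_head.
    case: p {E} => l [b [i [i' [j [j' z]]]]] /valid_paramP[_ _ _].
    by rewrite [X in _ < X]n0.
  apply: uniq_perm; rewrite ?enum_uniq // => S; rewrite mem_enum !inE.
  apply/esym/negP => /mapP[p]; rewrite mem_edge_params.
  case: p => l [b [i [i' [j [j' z]]]]] /valid_paramP[_ _ _].
  by rewrite [X in _ < X]n0.
(* The default of [insubd] never occurs, as the vertices of valid parameters are below [n]. It
   requires a vertex, hence the separate case [n = 0]. *)
pose t (p : param) : 5.-tuple 'I_n :=
  [tuple insubd (Ordinal n0) (nth 0 (block_verts p) i) | i < 5].
have tE p : valid_param n p -> [seq val v | v <- t p] = block_verts p.
  move=> gp; apply: (@eq_from_nth _ 0); rewrite size_map size_tuple.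
    by rewrite size_block_verts.
  move=> i i5; rewrite (nth_map (Ordinal n0)) ?size_tuple //.
  rewrite -(tnth_nth _ _ (Ordinal i5)) tnth_mktuple val_insubd.
  by rewrite (block_verts_lt gp) // mem_nth // size_block_verts.
exists [seq t p | p <- edge_params]; split.
  rewrite /edge_list -/edge_params -map_comp; congr flatten.
  apply/eq_in_map => p pg; rewrite mem_edge_params in pg.
  by rewrite /= tE // edge_vertsE //; case/andP: pg.
rewrite -map_comp (_ : map _ _ = map edge_set edge_params).
  apply: uniq_perm; rewrite ?enum_uniq ?map_edge_set_uniq // => S.
  by rewrite mem_enum inE.
apply/eq_in_map => p; rewrite mem_edge_params => gp.
apply/setP => v; rewrite -[LHS]/(v \in [set w in tval (t p)]) in_set in_set.
by rewrite -(tE p gp) (mem_map val_inj).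
Qed.

Lemma system_indep_number l : n <= 3 ^ l -> 3 ^ l < 3 * n ->
  indep_number system <= 9 * 2 ^ l.
Proof.
move=> nl ln; apply/bigmax_leqP => I /forall_inP indI.
rewrite cardE -(size_map val).
apply: (@independent_size n) nl ln => [|v|p gp].
- by rewrite (map_inj_uniq val_inj) enum_uniq.
- by case/mapP=> w _ ->; apply: ltn_ord.
apply: contra (indI _ (mem_system gp)) => /allP h.
apply/subsetP => v; rewrite inE => /h /mapP[w].
by rewrite mem_enum => wI /val_inj ->.
Qed.

End Hypergraph.

(** * Numerical bounds *)

Local Open Scope ring_scope.

Lemma ln3_gt0 (R : realType) : 0 < ln 3 :> R.
Proof. by rewrite ln_gt0 // ltr1n. Qed.

(** After clearing denominators this is the integer inequality [2 ^ 1000 <= 3 ^ 631]. *)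
Lemma log3_2_le (R : realType) : ln 2 / ln 3 <= 631 / 1000 :> R.
Proof.
rewrite ler_pdivrMr ?ln3_gt0 // mulrAC ler_pdivlMr ?ltr0n // mulrC.
rewrite !mulr_natl -!lnXn ?ltr0n //.
rewrite ler_ln ?posrE ?exprn_gt0 ?ltr0n // -!natrX ler_nat.
by lia.
Qed.

(** With [c = ln 2 / ln 3] one has [3^c = 2], so [2^l = (3^l)^c <= (3n)^c = 2 n^c]. *)
Lemma pow2_le (R : realType) (n l : nat) : (3 ^ l < 3 * n)%N ->
  2 ^+ l <= 2 * n%:R `^ (ln 2 / ln 3) :> R.
Proof.
move=> h; have l3 := ln3_gt0 R; set c := ln 2 / ln 3.
have c0 : 0 <= c by rewrite divr_ge0 ?ln_ge0 ?ler1n.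
have p3 : 3 `^ c = 2 :> R.
  rewrite /powR pnatr_eq0 /= /c divfK ?gt_eqF //.
  by rewrite lnK // posrE ltr0n.
rewrite -{1}p3 -powR_mulrn ?powR_ge0 // -powRrM mulrC powRrM powR_mulrn ?ler0n //.
rewrite -p3 -powRM ?ler0n //
  (ge0_ler_powR c0) ?nnegrE ?exprn_ge0 ?mulr_ge0 ?ler0n //.
by rewrite -natrX -natrM ler_nat ltnW.
Qed.

Theorem theorem1p7 (R : realType) :
  exists C : R, 0 < C /\
    explicit_construction 5 4 (fun (n : nat) (H : {set {set 'I_n}}) =>
      (indep_number H)%:R <= C * n%:R `^ (ln 2 / ln 3)
                          <= C * n%:R `^ (631 / 1000)).
Proof.
(* [18 = 9 * 2]: the 9 comes from [system_indep_number], the 2 from [pow2_le]. *)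
exists 18; split; first by rewrite ltr0n.
have [p [a [b [k run]]]] := edge_list_program.
exists p, a, b, k => n; have [t [comp bound]] := run n.
exists (flatten (edge_list (4 * n + 4) n)), t; split=> // n5.
exists (system n); split; [exact: system_listed | exact: system_is_system |].
apply/andP; split; last first.
  by rewrite ler_wpM2l ?ler0n // ler_powR ?log3_2_le // ler1n (leq_trans _ n5).
(* [l] is the logarithm of [n] to base 3, rounded up. *)
have [l nl ln] : exists2 l, (n <= 3 ^ l)%N & (3 ^ l < 3 * n)%N.
  exists (up_log 3 n); first exact: up_logP.
  have : (0 < up_log 3 n)%N by rewrite up_log_gt0 /= (leq_trans _ n5).
  have := @up_log_gtn 3 n isT (leq_trans (isT : 1 < 5)%N n5).
  by case: (up_log 3 n) => // l h _; rewrite expnS ltn_pmul2l.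
apply: (@le_trans _ _ (9 * 2 ^+ l)).
  by rewrite -natrX -natrM ler_nat; apply: system_indep_number.
rewrite (_ : 18 = 9 * 2) -?natrM // natrM -mulrA ler_wpM2l ?ler0n //.
exact: pow2_le.
Qed.
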